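(* Let $F:\mathbb{R}^n\times\mathbb{R}^n\to\mathbb{R}$ be a Hamiltonian such that (F1) $F$ is bounded and uniformly continuous on $\mathbb{R}^n\times B_R$ for every $R>0$; (F2) $\inf_{x\in\mathbb{R}^n}F(x,p)\to+\infty$ as $|p|\to+\infty$. Let $u_0:\mathbb{R}^n\to\mathbb{R}$ be uniformly continuous. Then there exists a unique uniformly continuous function $u:[0,+\infty)\times\mathbb{R}^n\to\mathbb{R}$ with $u(0,\cdot)=u_0$ that solves $$\partial_tu+F(x,D_xu)=0\qquad\text{in }(0,+\infty)\times\mathbb{R}^n$$ in the viscosity sense. If $u_0$ is Lipschitz in $\mathbb{R}^n$, then $u$ is Lipschitz continuous in $[0,+\infty)\times\mathbb{R}^n$ and its Lipschitz constant only depends on $\|Du_0\|_\infty$ and $F$.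
   Context: $B_R$ denotes the ball of radius $R$ centered at $0$ in $\mathbb{R}^n$. A Hamiltonian is a continuous function. A continuous function $u$ on $(0,+\infty)\times\mathbb{R}^n$ is a viscosity subsolution (resp. supersolution) of $\partial_tu+F(x,D_xu)=0$ if for every $C^1$ function $\varphi$ such that $u-\varphi$ attains a local maximum (resp. local minimum) at a point $(t,x)\in(0,+\infty)\times\mathbb{R}^n$, one has $\partial_t\varphi(t,x)+F(x,D_x\varphi(t,x))\le0$ (resp. $\ge0$). It is a viscosity solution if it is both a sub- and a supersolution. *)

(* Defs.v *)
From HB Require Import structures.
From mathcomp Require Import all_boot all_order all_algebra.
From mathcomp Require Import all_classical all_reals all_analysis.

Set Implicit Arguments.
Unset Strict Implicit.
Unset Printing Implicit Defensive.

Import Order.TTheory GRing.Theory Num.Theory.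
Import numFieldNormedType.Exports.

Local Open Scope classical_set_scope.
Local Open Scope ring_scope.

(* MathComp-Analysis equips 'rV[R]_n and products with the sup norm.  It is
   used below only through the topology and the uniformity it induces, which
   are the usual ones; balls, |p| and Lipschitz constants are Euclidean. *)
Definition enorm (R : realType) (n : nat) (x : 'rV[R]_n) : R :=
  Num.sqrt (\sum_(i < n) x ord0 i ^+ 2).

Definition eball (R : realType) (n : nat) (r : R) : set 'rV[R]_n :=
  [set x | enorm x < r].

Definition st_enorm (R : realType) (n : nat) (q : R * 'rV[R]_n) : R :=
  Num.sqrt (q.1 ^+ 2 + enorm q.2 ^+ 2).

Definition open_halfspace (R : realType) (n : nat) : set (R * 'rV[R]_n) :=
  [set q | 0 < q.1].

Definition closed_halfspace (R : realType) (n : nat) : set (R * 'rV[R]_n) :=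
  [set q | 0 <= q.1].

(* The uniformity of subspace A is the trace on A of that of V, so the values
   of f outside A play no role. *)
Definition unif_continuous_on (R : realType) (V : normedModType R)
    (A : set V) (f : V -> R) : Prop :=
  unif_continuous (f : subspace A -> R).

Definition hamiltonian (R : realType) (n : nat)
    (F : 'rV[R]_n * 'rV[R]_n -> R) : Prop :=
  continuous F.

Definition cond_F1 (R : realType) (n : nat)
    (F : 'rV[R]_n * 'rV[R]_n -> R) : Prop :=
  forall r : R, 0 < r ->
    [bounded F q | q in [set: 'rV[R]_n] `*` @eball R n r] /\
    unif_continuous_on ([set: 'rV[R]_n] `*` @eball R n r) F.

(* The real-valued inf is the true infimum only on sets that are bounded below
   (it is 0 otherwise); here this is ensured by cond_F1. *)
Definition cond_F2 (R : realType) (n : nat)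
    (F : 'rV[R]_n * 'rV[R]_n -> R) : Prop :=
  forall M : R, exists r : R, forall p : 'rV[R]_n,
    r <= enorm p -> M <= inf [set F (x, p) | x in [set: 'rV[R]_n]].

Definition dt (R : realType) (n : nat) (phi : R * 'rV[R]_n -> R)
    (q : R * 'rV[R]_n) : R :=
  'D_((1, 0) : R * 'rV[R]_n) phi q.

Definition Dx (R : realType) (n : nat) (phi : R * 'rV[R]_n -> R)
    (q : R * 'rV[R]_n) : 'rV[R]_n :=
  \row_(i < n) 'D_((0, delta_mx ord0 i) : R * 'rV[R]_n) phi q.

(* phi is C^1 on the open set (0, +oo) x R^n. *)
Definition C1_test (R : realType) (n : nat) (phi : R * 'rV[R]_n -> R) : Prop :=
  forall q : R * 'rV[R]_n, open_halfspace q ->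
    [/\ differentiable phi q,
        {for q, continuous (dt phi)} & {for q, continuous (Dx phi)}].

Definition local_max (R : realType) (V : normedModType R) (f : V -> R)
    (q : V) : Prop :=
  \forall q' \near q, f q' <= f q.

Definition local_min (R : realType) (V : normedModType R) (f : V -> R)
    (q : V) : Prop :=
  \forall q' \near q, f q <= f q'.

Definition viscosity_subsolution (R : realType) (n : nat)
    (F : 'rV[R]_n * 'rV[R]_n -> R) (u : R * 'rV[R]_n -> R) : Prop :=
  (forall q, open_halfspace q -> {for q, continuous u}) /\
  forall (phi : R * 'rV[R]_n -> R) (q : R * 'rV[R]_n),
    C1_test phi -> open_halfspace q ->
    local_max (fun q' => u q' - phi q') q ->
    dt phi q + F (q.2, Dx phi q) <= 0.

Definition viscosity_supersolution (R : realType) (n : nat)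
    (F : 'rV[R]_n * 'rV[R]_n -> R) (u : R * 'rV[R]_n -> R) : Prop :=
  (forall q, open_halfspace q -> {for q, continuous u}) /\
  forall (phi : R * 'rV[R]_n -> R) (q : R * 'rV[R]_n),
    C1_test phi -> open_halfspace q ->
    local_min (fun q' => u q' - phi q') q ->
    0 <= dt phi q + F (q.2, Dx phi q).

Definition viscosity_solution (R : realType) (n : nat)
    (F : 'rV[R]_n * 'rV[R]_n -> R) (u : R * 'rV[R]_n -> R) : Prop :=
  viscosity_subsolution F u /\ viscosity_supersolution F u.

(* A function on [0, +oo) x R^n is represented by a total function on
   R x R^n whose values at negative times are irrelevant. *)
Definition uc_solution (R : realType) (n : nat)
    (F : 'rV[R]_n * 'rV[R]_n -> R) (u0 : 'rV[R]_n -> R)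
    (u : R * 'rV[R]_n -> R) : Prop :=
  [/\ unif_continuous_on (@closed_halfspace R n) u,
      forall x, u (0, x) = u0 x
    & viscosity_solution F u].

Definition lipschitz_with (R : realType) (V : zmodType) (N : V -> R)
    (A : set V) (k : R) (f : V -> R) : Prop :=
  forall x y, A x -> A y -> `|f x - f y| <= k * N (x - y).

(* ||Du||_oo for a Lipschitz function u on R^n, understood as usual as the
   best Lipschitz constant of u. *)
Definition grad_sup_norm (R : realType) (n : nat) (u : 'rV[R]_n -> R) : R :=
  sup [set `|u z.1 - u z.2| / enorm (z.1 - z.2) |
       z in [set z : 'rV[R]_n * 'rV[R]_n | z.1 != z.2]].

(* Main.v *)
Require Import Defs.
From HB Require Import structures.
From mathcomp Require Import all_boot all_order all_algebra.
From mathcomp Require Import all_classical all_reals all_analysis.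
From mathcomp Require Import ring lra.

(* For Lipschitz u0 the solution is the supremum of the subsolutions v that start
   from u0, lie above u0 - C t, have upper time slope C and are L-Lipschitz in
   x.  Delaying v by h and starting it from u0 - C t bounds the time slope of the
   supremum from below.  If the supremum failed to be a supersolution where
   phi touches it from below, then d_t phi < C because F >= -C, and |D phi| is
   bounded because d_t phi >= -C and F is coercive.  A cone with that slope can
   then be glued on top of the supremum without leaving the class, a
   contradiction.

   Comparison is needed only when one of the two functions is Lipschitz: doubling
   the variables then keeps the momenta bounded, so that the uniform continuity
   of F on bounded momenta suffices.  Inf-convolution approximates a uniformly
   continuous u0 from below by Lipschitz data up to e, comparison makes the
   corresponding solutions converge uniformly to a solution, and any other
   solution is compared with these Lipschitz approximants. *)

Set Implicit Arguments.
Unset Strict Implicit.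
Unset Printing Implicit Defensive.

Import Order.TTheory GRing.Theory Num.Theory.
Import numFieldNormedType.Exports.

Local Open Scope classical_set_scope.
Local Open Scope ring_scope.

(** * Norms and moduli of continuity *)

(** Slope bounds are built into the Perron class so that, together with the delay argument, they
    make the supremum Lipschitz and semicontinuous envelopes are avoided. The price is that the bump
    must respect these bounds, which is why it is a cone with explicit slopes and not a perturbed
    test function. The constants [C] and [L] are fixed by [F] and a Lipschitz bound before the datum
    is given; this makes the final Lipschitz constant uniform. Condition (F1) controls the
    dependence of [F] on [x] only for bounded momenta, whereas the momentum [2k(a - c)] of the
    doubling may blow up with [k]. For an [L]-Lipschitz [v], testing the maximum point [(a, c)]
    against [(a, a)] gives [k |a - c| <= L]. This treats a Lipschitz supersolution; a Lipschitz
    subsolution is reached by changing the sign of the unknown. That change destroys coercivity but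
    preserves [ham_uc], so comparison is formulated with [ham_uc]. Estimates are made in the sup
    norm; Euclidean quantities enter through the quadratic penalties, which must be C^1, and in the
    hypotheses and final constants. *)

Section Norms.
Context {R : realType} {n : nat}.
Implicit Types (x p : 'rV[R]_n) (q : R * 'rV[R]_n).

Lemma coord_le_norm x i : `|x ord0 i| <= `|x|.
Proof.
rewrite [leRHS]/Num.Def.normr /= mx_normrE; apply/bigmax_geP; right => /=.
by exists (ord0, i).
Qed.

Lemma norm_le_coord x c : 0 <= c -> (forall i, `|x ord0 i| <= c) -> `|x| <= c.
Proof.
move=> c0 xc; rewrite [leLHS]/Num.Def.normr /= mx_normrE; apply/bigmax_leP; split => //=.
by move=> -[i j] _ /=; rewrite (ord1 i).
Qed.

Lemma norm_le_enorm x : `|x| <= enorm x.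
Proof.
apply: norm_le_coord; first exact: sqrtr_ge0.
move=> i; rewrite -sqrtr_sqr ler_wsqrtr// (bigD1 i)//= lerDl.
by apply: sumr_ge0 => j _; exact: sqr_ge0.
Qed.

Lemma sqr_enorm x : enorm x ^+ 2 = \sum_(i < n) x ord0 i ^+ 2.
Proof. by rewrite sqr_sqrtr// sumr_ge0// => i _; exact: sqr_ge0. Qed.

Lemma enorm_le_norm x : enorm x <= n%:R * `|x|.
Proof.
have n0 : 0 <= n%:R * `|x| by rewrite mulr_ge0.
rewrite -(ger0_norm n0) -sqrtr_sqr ler_wsqrtr//.
apply: (@le_trans _ _ (n%:R * `|x| ^+ 2)).
  have -> : n%:R * `|x| ^+ 2 = \sum_(i < n) `|x| ^+ 2.
    by rewrite sumr_const card_ord mulr_natl.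
  apply: ler_sum => i _.
  by rewrite -[leLHS]real_normK ?num_real// lerXn2r ?nnegrE// coord_le_norm.
rewrite exprMn ler_wpM2r ?sqr_ge0// expr2.
by case: (n) => [|m]; rewrite ?mul0r// ler_peMl// ler1n.
Qed.

Lemma prod_norm_lt q c : (`|q| < c) = (`|q.1| < c) && (`|q.2| < c).
Proof. by rewrite prod_normE gt_max. Qed.

Lemma prod_norm_le q c : (`|q| <= c) = (`|q.1| <= c) && (`|q.2| <= c).
Proof. by rewrite prod_normE ge_max. Qed.

Lemma norm_fst_le q : `|q.1| <= `|q|.
Proof. by have := prod_norm_le q `|q|; rewrite lexx => /esym/andP[]. Qed.

Lemma norm_snd_le q : `|q.2| <= `|q|.
Proof. by have := prod_norm_le q `|q|; rewrite lexx => /esym/andP[]. Qed.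

Lemma norm_le_st_enorm q : `|q| <= st_enorm q.
Proof.
rewrite prod_norm_le; apply/andP; split.
  by rewrite -sqrtr_sqr ler_wsqrtr// lerDl sqr_ge0.
apply: le_trans (norm_le_enorm _) _.
have /ger0_norm <- : 0 <= enorm q.2 by exact: sqrtr_ge0.
by rewrite -sqrtr_sqr ler_wsqrtr// lerDr sqr_ge0.
Qed.

End Norms.

(** * Epsilon-delta forms of continuity *)

Section EpsDelta.
Context {R : realType} {V : normedModType R}.

Lemma nearP_norm (q : V) (P : set V) :
  (\forall q' \near q, P q') <->
  exists2 r : R, 0 < r & forall q', `|q' - q| < r -> P q'.
Proof.
split.
  move=> /nbhs_normP[r /= r0 rP]; exists r => // q' q'r.
  by apply: rP => /=; rewrite distrC.
move=> [r r0 rP]; apply/nbhs_normP; exists r => //= q' /= q'r.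
by apply: rP; rewrite distrC.
Qed.

Lemma contP_norm (W : normedModType R) (f : V -> W) (q : V) :
  {for q, continuous f} <->
  forall e : R, 0 < e -> exists2 d : R, 0 < d &
    forall q', `|q' - q| < d -> `|f q' - f q| < e.
Proof.
split.
  move=> /cvgrPdist_lt fq e e0; have /nearP_norm[d d0 dP] := fq e e0.
  by exists d => // q' /dP; rewrite distrC.
move=> H; apply/cvgrPdist_lt => e e0; apply/nearP_norm.
by have [d d0 dP] := H e e0; exists d => // q' /dP; rewrite distrC.
Qed.

Lemma ucP_norm (f : V -> R) : unif_continuous f <->
  forall e : R, 0 < e -> exists2 d : R, 0 < d &
    forall x y, `|x - y| < d -> `|f x - f y| < e.
Proof.
rewrite unif_continuousP; split => H e e0; have [d d0 dP] := H e e0.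
  exists d => // x y xy; have := dP (x, y).
  by rewrite -!ball_normE/=; apply.
by exists d => // -[x y]; rewrite -!ball_normE/=; apply: dP.
Qed.

Lemma uconP_norm (A : set V) (f : V -> R) : unif_continuous_on A f <->
  forall e : R, 0 < e -> exists2 d : R, 0 < d &
    forall x y, A x -> A y -> `|x - y| < d -> `|f x - f y| < e.
Proof.
rewrite /unif_continuous_on unif_continuousP; split => H e e0; have [d d0 dP] := H e e0.
  exists d => // x y Ax Ay xy; have := dP (x, y).
  rewrite ball_subspace_ball /subspace_ball -!ball_normE/=.
  by rewrite mem_set//; apply.
exists d => // -[x y] /=; rewrite ball_subspace_ball /subspace_ball -!ball_normE/=.
(* Outside [A] the balls of the subspace are singletons, so the two points coincide there. *)
by case: ifPn => [/set_mem Ax [Ay xy]|_ ->]; [exact: dP|rewrite subrr normr0].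
Qed.

End EpsDelta.


(** * Test functions *)

Section Derivatives.
Context {R : realType} {V : normedModType R}.
Implicit Types (f g : V -> R) (q v : V).

Lemma diff_approx f q : differentiable f q ->
  forall e : R, 0 < e -> exists2 r : R, 0 < r &
    forall q', `|q' - q| < r -> `|f q' - f q - 'd f q (q' - q)| <= e * `|q' - q|.
Proof.
move=> dfq e e0.
have /eqaddoP H := diff_locally dfq.
have /nearP_norm[r r0 rP] := H e e0; exists r => // q' q'r.
have := rP (q' - q); rewrite subr0 => /(_ q'r).
by rewrite /= !fctE subrK opprD addrA.
Qed.

(** One-sided difference quotients suffice. This turns slope bounds of a nonsmooth function into
    derivative bounds of a test function touching it. *)
Lemma derive_ge f q v (c r : R) : differentiable f q -> 0 < r ->
  (forall s, 0 < s -> s < r -> c * s <= f (q + s *: v) - f q) ->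
  c <= 'D_v f q.
Proof.
move=> dfq r0 H; rewrite deriveE//; apply/ler_addgt0Pr => e e0.
have N0 : 0 < `|v| + 1 by rewrite ltr_wpDl.
have [d d0 dP] := diff_approx dfq (divr_gt0 e0 N0).
(* A single small step is enough: the linearisation error is at most [e * s], which costs [e] after
   division by [s]. *)
pose s := Num.min (r / 2) (d / (2 * (`|v| + 1))).
have s0 : 0 < s by rewrite lt_min !divr_gt0// mulr_gt0.
have sr : s < r by apply: (@le_lt_trans _ _ (r / 2)); [rewrite ge_min lexx|lra].
have sd : s * `|v| < d.
  have : s * (2 * (`|v| + 1)) <= d.
    by rewrite -ler_pdivlMr ?mulr_gt0// ge_min lexx orbT.
  have : 0 <= s * `|v| by rewrite mulr_ge0// ltW.
  nra.
have := dP (q + s *: v); rewrite addrAC subrr add0r normrZ gtr0_norm// => /(_ sd).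
rewrite linearZ/= => /ler_normlW; have := H s s0 sr => h1 h2.
have h3 : e / (`|v| + 1) * (s * `|v|) <= e * s.
  have kN : e / (`|v| + 1) * (`|v| + 1) = e by rewrite divfK// gt_eqF.
  have := mulr_ge0 (ltW (divr_gt0 e0 N0)) (ltW s0).
  have : e * s = e / (`|v| + 1) * (`|v| + 1) * s by rewrite kN.
  lra.
rewrite -(ler_pM2r s0); move: h1 h2 h3; set D : R := 'd f q v.
by move: (f (q + s *: v)) => A; rewrite -[s *: D]/(s * D); nra.
Qed.

Lemma derive_le f q v (c r : R) : differentiable f q -> 0 < r ->
  (forall s, 0 < s -> s < r -> f (q + s *: v) - f q <= c * s) ->
  'D_v f q <= c.
Proof.
move=> dfq r0 H; rewrite -lerN2 -deriveN; last exact: diff_derivable.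
apply: (derive_ge (r := r)) => //; first exact: differentiableN.
by move=> s s0 sr; have := H s s0 sr; rewrite !fctE; lra.
Qed.

Lemma deriveNv f q v : differentiable f q -> 'D_(- v) f q = - 'D_v f q.
Proof. by move=> dfq; rewrite !deriveE// linearN. Qed.

Lemma derive_quadratic f q v (a b : R) : differentiable f q ->
  (forall s, f (q + s *: v) - f q = a * s + b * s ^+ 2) -> 'D_v f q = a.
Proof.
move=> dfq H; apply/eqP; rewrite eq_le.
have N0 : 0 < `|b| + 1 by rewrite ltr_wpDl.
have bound e s : 0 < e -> 0 < s -> s < e / (`|b| + 1) -> `|b * s ^+ 2| <= e * s.
  move=> e0 s0; rewrite ltr_pdivlMr// => se.
  rewrite normrM normrX (gtr0_norm s0); have := normr_ge0 b.
  by move: (`|b|) se => B; nra.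
apply/andP; split; apply/ler_addgt0Pr => e e0.
  apply: (derive_le (r := e / (`|b| + 1))); rewrite ?divr_gt0// => s s0 se.
  rewrite H; have := bound _ _ e0 s0 se; rewrite ler_norml => /andP[]; nra.
rewrite -lerBlDr; apply: (derive_ge (r := e / (`|b| + 1))); rewrite ?divr_gt0// => s s0 se.
rewrite H; have := bound _ _ e0 s0 se; rewrite ler_norml => /andP[]; nra.
Qed.

End Derivatives.

Section TestFunctions.
Context {R : realType} {n : nat}.
Local Notation V := (R * 'rV[R]_n)%type.
Implicit Types (phi psi : V -> R) (q : V).

Lemma ball_open_halfspace q q' : `|q' - q| < q.1 -> open_halfspace q'.
Proof.
rewrite prod_norm_lt => /andP[/=]; rewrite /open_halfspace /= ltr_norml.
by move=> /andP[]; lra.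
Qed.

Lemma eq_near_continuous (W W' : normedModType R) (f g : W -> W') (q : W) :
  (\forall q' \near q, f q' = g q') ->
  {for q, continuous g} -> {for q, continuous f}.
Proof.
move=> fg gq; rewrite /prop_for /continuous_at (nbhs_singleton fg).
apply: cvg_trans gq; apply: near_eq_cvg.
by apply: filterS fg => x ->.
Qed.

Lemma near_open_halfspace q : open_halfspace q ->
  \forall q' \near q, open_halfspace q'.
Proof.
by move=> q0; apply/nearP_norm; exists q.1 => // q'; exact: ball_open_halfspace.
Qed.

Lemma dtD phi psi q : differentiable phi q -> differentiable psi q ->
  dt (fun q => phi q + psi q) q = dt phi q + dt psi q.
Proof. by move=> h1 h2; rewrite /dt deriveD//; exact: diff_derivable. Qed.

Lemma DxD phi psi q : differentiable phi q -> differentiable psi q ->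
  Dx (fun q => phi q + psi q) q = Dx phi q + Dx psi q.
Proof.
by move=> h1 h2; apply/rowP => i; rewrite !mxE deriveD//; exact: diff_derivable.
Qed.

Lemma dtN phi q : differentiable phi q -> dt (fun q => - phi q) q = - dt phi q.
Proof. by move=> h1; rewrite /dt deriveN//; exact: diff_derivable. Qed.

Lemma DxN phi q : differentiable phi q -> Dx (fun q => - phi q) q = - Dx phi q.
Proof.
by move=> h1; apply/rowP => i; rewrite !mxE deriveN//; exact: diff_derivable.
Qed.

Lemma C1_testD phi psi : C1_test phi -> C1_test psi ->
  C1_test (fun q => phi q + psi q).
Proof.
move=> h1 h2 q q0; have [d1 t1 x1] := h1 q q0; have [d2 t2 x2] := h2 q q0.
split; first exact: differentiableD.
- apply: (eq_near_continuous (g := fun q => dt phi q + dt psi q)).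
    apply: filterS (near_open_halfspace q0) => q' q'0.
    by have [? _ _] := h1 q' q'0; have [? _ _] := h2 q' q'0; exact: dtD.
  exact: cvgD.
- apply: (eq_near_continuous (g := fun q => Dx phi q + Dx psi q)).
    apply: filterS (near_open_halfspace q0) => q' q'0.
    by have [? _ _] := h1 q' q'0; have [? _ _] := h2 q' q'0; exact: DxD.
  exact: cvgD.
Qed.

Lemma C1_testN phi : C1_test phi -> C1_test (fun q => - phi q).
Proof.
move=> h1 q q0; have [d1 t1 x1] := h1 q q0.
split; first exact: differentiableN.
- apply: (eq_near_continuous (g := fun q => - dt phi q)).
    apply: filterS (near_open_halfspace q0) => q' q'0.
    by have [? _ _] := h1 q' q'0; exact: dtN.
  exact: cvgN.
- apply: (eq_near_continuous (g := fun q => - Dx phi q)).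
    apply: filterS (near_open_halfspace q0) => q' q'0.
    by have [? _ _] := h1 q' q'0; exact: DxN.
  exact: cvgN.
Qed.

Lemma derive_shift phi (c v q : V) :
  'D_v (fun q => phi (q + c)) q = 'D_v phi (q + c).
Proof.
rewrite /derive; set F := (X in X @ _); set G := (X in _ = lim (X @ _)).
by have -> : F = G by apply/funext => h; rewrite /F /G /= addrA.
Qed.

Lemma dt_shift phi c q : dt (fun q => phi (q + c)) q = dt phi (q + c).
Proof. exact: derive_shift. Qed.

Lemma Dx_shift phi c q : Dx (fun q => phi (q + c)) q = Dx phi (q + c).
Proof. by apply/rowP => i; rewrite !mxE derive_shift. Qed.

Lemma continuous_shift (W : normedModType R) (f : V -> W) c q :
  {for q + c, continuous f} -> {for q, continuous (fun q => f (q + c))}.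
Proof.
move=> /contP_norm H; apply/contP_norm => e /H[d d0 dP]; exists d => // q' q'd.
by apply: dP; rewrite opprD addrACA subrr addr0.
Qed.

Lemma C1_test_shift phi (h : R) : 0 <= h -> C1_test phi ->
  C1_test (fun q => phi (q + (h, 0))).
Proof.
move=> h0 h1 q q0.
have qh : open_halfspace (q + (h, 0)) by rewrite /open_halfspace /= ltr_wpDr.
have [d1 t1 x1] := h1 _ qh; split.
- have dq : differentiable ((id : V -> V) + cst (h, 0 : 'rV[R]_n)) q.
    by apply: differentiableD => //; exact: differentiable_cst.
  exact: (differentiable_comp dq d1).
- have -> : dt (fun q => phi (q + (h, 0))) = fun q => dt phi (q + (h, 0)).
    by apply/funext => q'; exact: dt_shift.
  exact: continuous_shift.
- have -> : Dx (fun q => phi (q + (h, 0))) = fun q => Dx phi (q + (h, 0)).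
    by apply/funext => q'; exact: Dx_shift.
  exact: continuous_shift.
Qed.

(** Squares of coordinates are used because the squared sup norm is not C^1. The same family serves
    as strictness term, as doubling penalty and as penalty at infinity. *)
Definition quad (b k0 k1 : R) (c : V) (q : V) : R :=
  b * q.1 + k0 * (q.1 - c.1) ^+ 2
  + k1 * \sum_(i < n) (q.2 ord0 i - c.2 ord0 i) ^+ 2.

Lemma differentiable_coordinate q i :
  differentiable (fun q : V => q.2 ord0 i : R) q.
Proof.
apply: (@differentiable_comp _ _ _ _ snd (fun x : 'rV[R]_n => x ord0 i)).
  by apply: linear_differentiable => x; exact: cvg_snd.
exact: differentiable_coord.
Qed.

Lemma differentiable_time q : differentiable (fun q : V => q.1 : R) q.
Proof. by apply: linear_differentiable => x; exact: cvg_fst. Qed.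

Lemma differentiable_sqr phi q : differentiable phi q ->
  differentiable (fun q => phi q ^+ 2) q.
Proof.
move=> dphi; rewrite (_ : (fun _ => _) = phi * phi); first exact: differentiableM.
by apply/funext => x; rewrite expr2.
Qed.

Lemma quad_differentiable b k0 k1 c q : differentiable (quad b k0 k1 c) q.
Proof.
apply: differentiableD; first apply: differentiableD.
- apply: differentiableM; first exact: differentiable_cst.
  exact: differentiable_time.
- apply: differentiableM; first exact: differentiable_cst.
  apply: differentiable_sqr; apply: differentiableB; last exact: differentiable_cst.
  exact: differentiable_time.
- apply: differentiableM; first exact: differentiable_cst.
  rewrite (_ : (fun q : V => _) =
    \sum_(i < n) (fun q : V => (q.2 ord0 i - c.2 ord0 i) ^+ 2)); last first.
    by apply/funext => x; rewrite fct_sumE.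
  apply: differentiable_sum => i; apply: differentiable_sqr; apply: differentiableB.
    exact: differentiable_coordinate.
  exact: differentiable_cst.
Qed.

Lemma dt_quad b k0 k1 c q : dt (quad b k0 k1 c) q = b + 2 * k0 * (q.1 - c.1).
Proof.
apply: (derive_quadratic (b := k0)); first exact: quad_differentiable.
move=> s; rewrite /quad /= scaler0 addr0 -[s *: 1]/(s * 1); ring.
Qed.

Lemma Dx_quad b k0 k1 c q : Dx (quad b k0 k1 c) q = (2 * k1) *: (q.2 - c.2).
Proof.
apply/rowP => i; rewrite !mxE.
apply: (derive_quadratic (b := k1)); first exact: quad_differentiable.
move=> s; rewrite /quad /= scaler0 addr0.
rewrite (bigD1 i)//= [X in _ - X](_ : _ = b * q.1 + k0 * (q.1 - c.1) ^+ 2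
  + k1 * ((q.2 ord0 i - c.2 ord0 i) ^+ 2 +
     \sum_(j < n | j != i) (q.2 ord0 j - c.2 ord0 j) ^+ 2)); last first.
  by rewrite (bigD1 i).
under eq_bigr => j ji do rewrite !mxE eqxx (negbTE ji) /= mulr0 addr0.
rewrite !mxE !eqxx /=; ring.
Qed.

Lemma C1_quad b k0 k1 c : C1_test (quad b k0 k1 c).
Proof.
move=> q q0; split; first exact: quad_differentiable.
- rewrite (_ : dt _ = fun q => b + 2 * k0 * (q.1 - c.1)); last first.
    by apply/funext => q'; exact: dt_quad.
  apply: cvgD; first exact: cvg_cst.
  apply: cvgM; first exact: cvg_cst.
  by apply: cvgB; [exact: cvg_fst|exact: cvg_cst].
- rewrite (_ : Dx _ = fun q => (2 * k1) *: (q.2 - c.2)); last first.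
    by apply/funext => q'; exact: Dx_quad.
  apply: cvgZr.
  by apply: cvgB; [exact: cvg_snd|exact: cvg_cst].
Qed.

Lemma sqr_norm_le_quad (c q : V) : `|q - c| ^+ 2 <= quad 0 1 1 c q.
Proof.
rewrite /quad mul0r add0r !mul1r.
have -> : \sum_(i < n) (q.2 ord0 i - c.2 ord0 i) ^+ 2 = enorm (q.2 - c.2) ^+ 2.
  by rewrite sqr_enorm; apply: eq_bigr => i _; rewrite !mxE.
have -> : (q.1 - c.1) ^+ 2 + enorm (q.2 - c.2) ^+ 2 = st_enorm (q - c) ^+ 2.
  by rewrite [RHS]sqr_sqrtr// addr_ge0 ?sqr_ge0.
by rewrite lerXn2r ?nnegrE ?sqrtr_ge0// norm_le_st_enorm.
Qed.

End TestFunctions.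

(** * Duality and stability of viscosity inequalities *)

Section Compactness.
Context {R : realType} {n : nat}.
Local Notation V := (R * 'rV[R]_n)%type.

Lemma compact_norm_rV (c : 'rV[R]_n) (r : R) : compact [set x | `|x - c| <= r].
Proof.
apply: bounded_closed_compact.
  exists (r + `|c|); split; first by rewrite num_real.
  move=> M rM x /= xc; apply: le_trans (ltW rM).
  by rewrite -(subrK c x); apply: le_trans (ler_normD _ _) _; rewrite lerD2r.
rewrite (_ : [set x | _] = (fun x => `|x - c|) @^-1` [set s | s <= r])//.
apply: preimage_closed; last exact: closed_le.
move=> x _; apply/contP_norm => e e0; exists e => // y yx.
apply: le_lt_trans yx; rewrite (_ : y - x = (y - c) - (x - c)).
  exact: ler_dist_dist.
by rewrite opprB addrA subrK.
Qed.

Lemma compact_norm_prod (c : V) (r : R) : compact [set q | `|q - c| <= r].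
Proof.
rewrite (_ : [set q | _] = [set s | `|s - c.1| <= r] `*` [set x | `|x - c.2| <= r]).
  apply: compact_setX; last exact: compact_norm_rV.
  rewrite (_ : [set s | _] = `[c.1 - r, c.1 + r]%classic).
    exact: segment_compact.
  by apply/seteqP; split => s; rewrite /= in_itv /= ler_distl.
apply/seteqP; split => q; rewrite /= prod_norm_le /=; first by move=> /andP.
by move=> [-> ->].
Qed.

Lemma norm_ball_max (c : V) (r : R) (f : V -> R) : 0 <= r ->
  (forall q, `|q - c| <= r -> {for q, continuous f}) ->
  exists2 q, `|q - c| <= r & forall q', `|q' - c| <= r -> f q' <= f q.
Proof.
move=> r0 fc; have [||q /set_mem qr qmax] :=
    compact_EVT_max (A := [set q | `|q - c| <= r]) (f := f) _ (@compact_norm_prod c r).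
- by exists c; rewrite /= subrr normr0.
- by apply: continuous_in_subspaceT => q /set_mem/fc.
- by exists q => // q' q'r; apply: qmax; rewrite inE.
Qed.

End Compactness.

Section Duality.
Context {R : realType} {n : nat}.
Local Notation V := (R * 'rV[R]_n)%type.
Implicit Types (F : 'rV[R]_n * 'rV[R]_n -> R) (u v : V -> R).

(* Flips the sign of the unknown: [u] is a supersolution for [F] exactly when
   [- u] is a subsolution for [dual_ham F]. *)
Definition dual_ham F : 'rV[R]_n * 'rV[R]_n -> R := fun z => - F (z.1, - z.2).

Lemma dual_hamK F : dual_ham (dual_ham F) = F.
Proof. by apply/funext => -[x p]; rewrite /dual_ham /= !opprK. Qed.

Lemma continuous_dual_ham F : continuous F -> continuous (dual_ham F).
Proof.
move=> Fc z; apply/contP_norm => e e0.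
have /contP_norm/(_ e e0)[d d0 dP] := Fc (z.1, - z.2).
exists d => // z' z'z; rewrite /dual_ham -opprD normrN; apply: dP.
by move: z'z; rewrite !prod_normE /= -opprD normrN.
Qed.

Lemma continuousNfun (W : normedModType R) (f : W -> R) q :
  {for q, continuous f} -> {for q, continuous (fun x => - f x)}.
Proof. exact: cvgN. Qed.

Lemma subN_super F u : viscosity_subsolution (dual_ham F) (fun q => - u q) ->
  viscosity_supersolution F u.
Proof.
move=> [uc us]; split.
  move=> q /uc /continuousNfun; rewrite (_ : (fun x => _) = u)//.
  by apply/funext => x; rewrite opprK.
move=> phi q phi1 q0 qmin; have [d1 _ _] := phi1 q q0.
have := us _ q (C1_testN phi1) q0; rewrite dtN// DxN// /dual_ham /= opprK.
suff H : local_max (fun q' => - u q' - - phi q') q.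
  by move=> /(_ H); lra.
by apply: filterS qmin => q'; lra.
Qed.

Lemma super_subN F u : viscosity_supersolution F u ->
  viscosity_subsolution (dual_ham F) (fun q => - u q).
Proof.
move=> [uc us]; split; first by move=> q /uc /continuousNfun.
move=> phi q phi1 q0 qmin; have [d1 _ _] := phi1 q q0.
have := us _ q (C1_testN phi1) q0; rewrite dtN// DxN// /dual_ham /=.
suff H : local_min (fun q' => u q' - - phi q') q.
  by move=> /(_ H); lra.
by apply: filterS qmin => q'; lra.
Qed.

Lemma subN_superN F u : viscosity_subsolution F u ->
  viscosity_supersolution (dual_ham F) (fun q => - u q).
Proof.
move=> uF; apply: subN_super; rewrite dual_hamK.
by rewrite (_ : (fun q => _) = u)//; apply/funext => q; rewrite opprK.
Qed.

End Duality.

Lemma pick_below (R : realType) (a b c : R) : 0 < a -> 0 < b -> 0 < c ->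
  exists r, [/\ 0 < r, r < a, r < b & r < c].
Proof.
move=> a0 b0 c0; pose m := Num.min a (Num.min b c).
have m0 : 0 < m by rewrite !lt_min a0 b0.
have : m <= m by []; rewrite [in X in _ <= X]/m !le_min => /and3P[ma mb mc].
by exists (m / 2); split; lra.
Qed.

Section Stability.
Context {R : realType} {n : nat}.
Local Notation V := (R * 'rV[R]_n)%type.
Implicit Types (F : 'rV[R]_n * 'rV[R]_n -> R) (u v : V -> R).

(* Both suprema and uniform limits of subsolutions are covered by this form. *)
Lemma stability_sub F u : continuous F ->
  (forall q, open_halfspace q -> {for q, continuous u}) ->
  (forall q (e : R), open_halfspace q -> 0 < e -> exists v,
     [/\ viscosity_subsolution F v, u q - e <= v q
       & forall q', open_halfspace q' -> v q' <= u q' + e]) ->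
  viscosity_subsolution F u.
Proof.
move=> Fc uc H; split => // phi q phi1 q0 /nearP_norm[r1 r10 qmax].
rewrite leNgt; apply/negP => pos.
(* The added square vanishes to first order at [q], so the inequality to refute is unchanged, while
   the maximum becomes strict. *)
pose phi2 q' := phi q' + quad 0 1 1 q q'.
have phi21 : C1_test phi2 by apply: C1_testD => //; exact: C1_quad.
pose H2 q' := dt phi2 q' + F (q'.2, Dx phi2 q').
have H2q : H2 q = dt phi q + F (q.2, Dx phi q).
  have [d1 _ _] := phi1 q q0.
  have d2 := @quad_differentiable R n 0 1 1 q q.
  by rewrite /H2 dtD// DxD// dt_quad Dx_quad !subrr scaler0 mulr0 !addr0.
have H2c : {for q, continuous H2}.
  have [_ c1 c2] := phi21 q q0.
  apply: cvgD => //; apply: (@continuous_comp _ _ _ (fun q' : V => (q'.2, Dx phi2 q')) F).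
    move/contP_norm: c2 => c2; apply/contP_norm => e e0.
    have [d d0 dP] := c2 e e0; exists (Num.min d e); first by rewrite lt_min d0.
    move=> q'; rewrite lt_min => /andP[/dP dq q'e]; rewrite prod_normE gt_max /= dq andbT.
    exact: le_lt_trans (norm_snd_le (q' - q)) _.
  exact: Fc.
have /contP_norm/(_ (H2 q)) := H2c; rewrite H2q => /(_ pos)[r2 r20 r2P].
have [rho [rho0 rhoq rhor1 rhor2]] := pick_below q0 r10 r20.
(* On the sphere of radius [rho] the square costs at least [rho ^+ 2], more than the total error
   [rho ^+ 2 / 2] of replacing [u] by [v]; the maximum over the ball is therefore interior. *)
have [v [[vc vs] vq vu]] : exists v,
     [/\ viscosity_subsolution F v, u q - rho ^+ 2 / 4 <= v q
       & forall q', open_halfspace q' -> v q' <= u q' + rho ^+ 2 / 4].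
  by apply: H => //; rewrite divr_gt0// exprn_gt0.
have inball q' : `|q' - q| <= rho -> open_halfspace q'.
  by move=> q'q; apply: (@ball_open_halfspace R n q); apply: le_lt_trans q'q _.
have quad0 : quad 0 1 1 q q = 0 :> R.
  rewrite /quad mul0r add0r subrr expr0n mulr0 add0r mul1r big1// => i _.
  by rewrite subrr expr0n.
have [qm qmr qmmax] : exists2 q1, `|q1 - q| <= rho &
    forall q', `|q' - q| <= rho -> v q' - phi2 q' <= v q1 - phi2 q1.
  apply: norm_ball_max => [|q' q'r]; first exact: ltW.
  apply: cvgB; first by apply: vc; exact: inball.
  have [d2 _ _] := phi21 q' (inball _ q'r).
  exact: differentiable_continuous.
have rhoqm : `|qm - q| < rho.
  rewrite lt_neqAle qmr andbT; apply/eqP => qmrho.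
  have h1 := qmmax q; rewrite subrr normr0 in h1; have {}h1 := h1 (ltW rho0).
  have h2 : u qm - phi qm <= u q - phi q.
    by apply: qmax; rewrite qmrho.
  have h3 : rho ^+ 2 <= quad 0 1 1 q qm.
    by rewrite -qmrho; exact: sqr_norm_le_quad.
  have h4 := vu qm (inball _ qmr).
  have : 0 < rho ^+ 2 by rewrite exprn_gt0.
  move: h1 h2 h3 h4 vq; rewrite /phi2 quad0; lra.
have : H2 qm <= 0.
  apply: vs => //; first exact: inball.
  apply/nearP_norm; exists (rho - `|qm - q|); first by rewrite subr_gt0.
  move=> q' q'qm; apply: qmmax.
  rewrite -(subrK qm q') -addrA; apply: le_trans (ler_normD _ _) _.
  lra.
have := r2P qm (lt_trans rhoqm rhor2); move=> /ltr_normlP[]; lra.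
Qed.

End Stability.

(** * Comparison principle *)

(** The segment from [x] to [y] is cut into pieces shorter than [d], each of which changes [f] by
    less than [e]. *)
Lemma linear_growth (R : realType) (V : normedModType R) (A : set V)
    (f : V -> R) (e d : R) :
  (forall x y (s : R), A x -> A y -> 0 <= s -> s <= 1 -> A (x + s *: (y - x))) ->
  0 < e -> 0 < d ->
  (forall x y, A x -> A y -> `|x - y| < d -> `|f x - f y| < e) ->
  forall x y, A x -> A y -> `|f x - f y| <= e + e / d * `|x - y|.
Proof.
move=> Aconv e0 d0 fe x y Ax Ay.
pose N := (Num.truncn (`|x - y| / d)).+1.
have r0 : 0 <= `|x - y| / d by rewrite divr_ge0// ltW.
have /andP[N1 N2] := truncn_itv r0.
have N0 : 0 < N%:R :> R by rewrite ltr0n.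
pose z (k : nat) := x + (k%:R / N%:R) *: (y - x).
have Az k : (k <= N)%N -> A (z k).
  move=> kN; apply: Aconv => //.
  by rewrite ler_pdivrMr// mul1r ler_nat.
have step k : (k <= N)%N -> `|f x - f (z k)| <= k%:R * e.
  elim: k => [_|k IH kN].
    by rewrite /z !mul0r scale0r addr0 subrr normr0.
  rewrite (_ : f x - _ = (f x - f (z k)) + (f (z k) - f (z k.+1))); last first.
    by rewrite addrA subrK.
  apply: le_trans (ler_normD _ _) _; rewrite -natr1 mulrDl mul1r lerD//.
    by apply: IH; exact: ltnW.
  apply/ltW/fe; [apply: Az; exact: ltnW|exact: Az|].
  rewrite /z opprD addrACA subrr add0r -scalerBl -mulrBl -natr1 opprD addrA.
  rewrite subrr sub0r mulN1r scaleNr normrN normrZ distrC ger0_norm ?invr_ge0 ?ltW//.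
  by rewrite mulrC ltr_pdivrMr// mulrC -ltr_pdivrMr.
have := step N (leqnn N); rewrite /z divff ?gt_eqF// scale1r (addrC x) subrK => fN.
apply: le_trans fN _; rewrite -mulrA [d^-1 * _]mulrC /N -natr1.
by have := ler_wpM2l (ltW e0) N1; lra.
Qed.

Section Comparison.
Context {R : realType} {n : nat}.
Local Notation V := (R * 'rV[R]_n)%type.
Implicit Types (F : 'rV[R]_n * 'rV[R]_n -> R) (u v : V -> R).

Definition ham_uc F := forall r e : R, 0 < e -> exists2 d : R, 0 < d &
  forall x y p p', `|p| <= r -> `|p'| <= r -> `|x - y| < d -> `|p - p'| < d ->
    `|F (x, p) - F (y, p')| < e.

Lemma cond_F1_uc F : cond_F1 F -> ham_uc F.
Proof.
move=> F1 r e e0.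
have [|_ /uconP_norm/(_ e e0)[d d0 dP]] := F1 (n%:R * `|r| + 1).
  by rewrite ltr_wpDl// mulr_ge0.
exists d => // x y p p' pr p'r xy pp'; apply: dP.
- split => //; rewrite /eball/=; apply: le_lt_trans (enorm_le_norm _) _.
  by rewrite ltr_pwDr// ler_wpM2l// (le_trans pr)// ler_norm.
- split => //; rewrite /eball/=; apply: le_lt_trans (enorm_le_norm _) _.
  by rewrite ltr_pwDr// ler_wpM2l// (le_trans p'r)// ler_norm.
- by rewrite prod_normE gt_max /= xy.
Qed.

Lemma dual_ham_uc F : ham_uc F -> ham_uc (dual_ham F).
Proof.
move=> H r e e0; have [d d0 dP] := H r e e0; exists d => // x y p p' pr p'r xy pp'.
rewrite /dual_ham /= -opprD normrN; apply: dP => //; rewrite ?normrN//.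
by rewrite -opprD normrN.
Qed.

(** A 1-Lipschitz retraction onto the closed half-space: composing with it gives functions
    continuous everywhere, to which compactness of full balls applies. *)
Definition clamp (q : V) : V := (Num.max 0 q.1, q.2).

Lemma clamp_closed q : closed_halfspace (clamp q).
Proof. by rewrite /closed_halfspace /= le_max lexx. Qed.

Lemma clamp_id q : closed_halfspace q -> clamp q = q.
Proof. by case: q => t x; rewrite /closed_halfspace /clamp /= => t0; rewrite max_r. Qed.

Lemma clamp_contract q q' : `|clamp q - clamp q'| <= `|q - q'|.
Proof.
rewrite prod_norm_le; apply/andP; split; last exact: (norm_snd_le (q - q')).
apply: le_trans (norm_fst_le _); rewrite /=; case: (leP 0 q.1) => h; case: (leP 0 q'.1) => h' //.
- by rewrite subr0 !ger0_norm//; lra.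
- by rewrite sub0r normrN (ger0_norm h') ler0_norm; lra.
- by rewrite subr0 normr0.
Qed.

Lemma uc_clamp_continuous u : unif_continuous_on (@closed_halfspace R n) u ->
  continuous (u \o clamp).
Proof.
move=> /uconP_norm uu q; apply/contP_norm => e e0.
have [d d0 dP] := uu e e0; exists d => // q' q'd.
apply: dP; [exact: clamp_closed|exact: clamp_closed|].
exact: le_lt_trans (clamp_contract _ _) q'd.
Qed.

Lemma uc_continuous_open u q : unif_continuous_on (@closed_halfspace R n) u ->
  open_halfspace q -> {for q, continuous u}.
Proof.
move=> /uconP_norm uu q0; apply/contP_norm => e e0; have [d d0 dP] := uu e e0.
have [r [r0 rd rq _]] := pick_below d0 q0 ltr01.
exists r => // q' q'q; apply: dP (lt_trans q'q rd); last exact: ltW.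
exact: ltW (ball_open_halfspace (lt_trans q'q rq)).
Qed.

Lemma closed_halfspace_convex (x y : V) (s : R) : closed_halfspace x ->
  closed_halfspace y -> 0 <= s -> s <= 1 -> closed_halfspace (x + s *: (y - x)).
Proof.
rewrite /closed_halfspace /= => x0 y0 s0 s1; rewrite -[s *: _]/(s * _); nra.
Qed.

Lemma norm_ball_max2 (f : V * V -> R) (r r' : R) : 0 <= r -> 0 <= r' ->
  continuous f ->
  exists a b, [/\ `|a| <= r, `|b| <= r' &
    forall q q', `|q| <= r -> `|q'| <= r' -> f (q, q') <= f (a, b)].
Proof.
move=> r0 r'0 fc.
pose B (r : R) := [set q : V | `|q - 0| <= r].
have [||c /set_mem [c1 c2] cmax] := compact_EVT_max (A := B r `*` B r') (f := f)
    _ (compact_setX (compact_norm_prod (c := 0) (r := r))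
                    (compact_norm_prod (c := 0) (r := r'))).
- by exists (0, 0); rewrite /B /= subrr normr0.
- exact: continuous_subspaceT.
move: c1 c2; rewrite /B /= !subr0 => c1 c2; exists c.1, c.2; split => //.
move=> q q' qr q'r; have := cmax (q, q'); rewrite -surjective_pairing; apply.
by rewrite inE; split; rewrite /B /= subr0.
Qed.

End Comparison.

(** * Doubling of variables: penalties and a priori bounds *)

Section ComparisonPrinciple.
Context {R : realType} {n : nat}.
Local Notation V := (R * 'rV[R]_n)%type.
Implicit Types (F : 'rV[R]_n * 'rV[R]_n -> R) (u v : V -> R).

Definition sqdist (q q' : V) : R := quad 0 1 1 0 (q - q').

Lemma quad_sqdist (k : R) (c q : V) : quad 0 k k c q = k * sqdist q c.
Proof.
rewrite /sqdist /quad /= !mul0r !add0r !mul1r mulrDr subr0; congr (_ + _ * _).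
by apply: eq_bigr => i _; rewrite !mxE subr0.
Qed.

Lemma sqdistC (q q' : V) : sqdist q q' = sqdist q' q.
Proof.
rewrite /sqdist /quad /= !mul0r !add0r !mul1r !subr0; congr (_ + _).
  by rewrite -sqrrN opprB.
by apply: eq_bigr => i _; rewrite !mxE !subr0 -sqrrN opprB.
Qed.

Lemma sqr_norm_le_sqdist (q q' : V) : `|q - q'| ^+ 2 <= sqdist q q'.
Proof. by have := sqr_norm_le_quad 0 (q - q'); rewrite subr0. Qed.

Lemma sqdistxx (q : V) : sqdist q q = 0.
Proof.
rewrite /sqdist /quad /= !mul0r !add0r !mul1r subrr subr0 expr0n add0r big1// => i _.
by rewrite !mxE subrr subr0 expr0n.
Qed.

(** The term [e * q.1] provides the strict excess [e] in the subsolution inequality; [e * q.1 ^+ 2]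
    confines time, its time derivative having the favourable sign; the [b] term confines space. *)
Lemma quad_penalty (e b : R) (q : V) :
  quad e e b 0 q = e * q.1 + e * q.1 ^+ 2 + b * quad 0 0 1 0 q.
Proof. by rewrite /quad /= !mul0r !add0r subr0; congr (_ + _); rewrite mul1r. Qed.

Lemma sqr_norm_snd_le_quad (q : V) : `|q.2| ^+ 2 <= quad 0 0 1 0 q.
Proof.
rewrite /quad /= !mul0r !add0r mul1r.
under eq_bigr do rewrite mxE subr0.
by rewrite -sqr_enorm lerXn2r ?nnegrE ?sqrtr_ge0// norm_le_enorm.
Qed.

Lemma continuous_quad (b k0 k1 : R) (c : V) : continuous (quad b k0 k1 c).
Proof.
by move=> q; apply: differentiable_continuous; exact: quad_differentiable.
Qed.

Lemma continuous_clamp : continuous (@clamp R n).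
Proof.
move=> q; apply/contP_norm => e e0; exists e => // q' q'q.
exact: le_lt_trans (clamp_contract _ _) q'q.
Qed.

Lemma lipschitz_clamp_continuous v (L : R) : 0 <= L ->
  (forall q q', closed_halfspace q -> closed_halfspace q' ->
    `|v q - v q'| <= L * `|q - q'|) -> unif_continuous_on (@closed_halfspace R n) v.
Proof.
move=> L0 vL; apply/uconP_norm => e e0.
have L1 : 0 < L + 1 by rewrite ltr_wpDl.
exists (e / (L + 1)); first exact: divr_gt0.
move=> q q' q0 q'0; rewrite ltr_pdivlMr// => qq'.
apply: le_lt_trans (vL _ _ q0 q'0) _; have := normr_ge0 (q - q'); lra.
Qed.

Lemma doubling_continuous u v (e b k : R) :
  unif_continuous_on (@closed_halfspace R n) u ->
  unif_continuous_on (@closed_halfspace R n) v ->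
  continuous (fun z : V * V => u (clamp z.1) - v (clamp z.2)
    - k * sqdist (clamp z.1) (clamp z.2) - quad e e b 0 (clamp z.1)).
Proof.
move=> uu vu z.
have c1 : {for z, continuous (fun z : V * V => clamp z.1)}.
  by apply: continuous_comp; [exact: cvg_fst|exact: continuous_clamp].
have c2 : {for z, continuous (fun z : V * V => clamp z.2)}.
  by apply: continuous_comp; [exact: cvg_snd|exact: continuous_clamp].
apply: cvgB; first apply: cvgB; first apply: cvgB.
- apply: (@continuous_comp _ _ _ (fun z : V * V => z.1) (u \o clamp)).
    exact: cvg_fst.
  exact: uc_clamp_continuous.
- apply: (@continuous_comp _ _ _ (fun z : V * V => z.2) (v \o clamp)).
    exact: cvg_snd.
  exact: uc_clamp_continuous.
- apply: cvgM; first exact: cvg_cst.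
  apply: (@continuous_comp _ _ _ (fun z : V * V => clamp z.1 - clamp z.2) (quad 0 1 1 0)).
    exact: cvgB.
  exact: continuous_quad.
- apply: (@continuous_comp _ _ _ (fun z : V * V => clamp z.1) (quad e e b 0)) => //.
  exact: continuous_quad.
Qed.

(** Both functions are carried to the point [(0, x)], where the initial inequality applies; half of
    the time penalty and part of the doubling penalty absorb the linear errors. The constant in
    parentheses depends neither on [b] nor on [k]. *)
Lemma doubling_bound u v (A L M e b k : R) : 0 <= L -> 0 <= M -> 0 < e -> 1 <= k ->
  (forall q q', closed_halfspace q -> closed_halfspace q' ->
    `|u q - u q'| <= 1 + M * `|q - q'|) ->
  (forall q q', closed_halfspace q -> closed_halfspace q' ->
    `|v q - v q'| <= L * `|q - q'|) ->
  (forall x, u (0, x) <= v (0, x) + A) ->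
  forall q q', closed_halfspace q -> closed_halfspace q' ->
  u q - v q' - k * sqdist q q' - quad e e b 0 q <=
  A + (1 + L ^+ 2 + (M + L) ^+ 2 / (2 * e))
    - e / 2 * q.1 ^+ 2 - `|q - q'| ^+ 2 / 4 - b * quad 0 0 1 0 q.
Proof.
move=> L0 M0 e0 k1 uM vL uv [t x] q' t0 q'0; rewrite quad_penalty /=.
have c1 := t0; rewrite /closed_halfspace /= in t0.
have c0 : closed_halfspace ((0, x) : V) by rewrite /closed_halfspace /=.
have N0 : `|((t, x) : V) - (0, x)| <= t.
  by rewrite prod_norm_le /= subr0 subrr normr0 t0 ger0_norm// lexx.
have h1 : u (t, x) - u (0, x) <= 1 + M * t.
  apply: le_trans (ler_norm _) _; apply: le_trans (uM _ _ c1 c0) _.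
  by rewrite lerD2l ler_wpM2l.
have h2 : v (0, x) - v q' <= L * (t + `|(t, x) - q'|).
  apply: le_trans (ler_norm _) _; apply: le_trans (vL _ _ c0 q'0) _.
  rewrite ler_wpM2l// (_ : _ - q' = - ((t, x) - (0, x)) + ((t, x) - q')).
    by apply: le_trans (ler_normD _ _) _; rewrite normrN lerD2r.
  by rewrite opprB addrA subrK.
have h3 := uv x; have h4 := sqr_norm_le_sqdist (t, x) q'.
(* Young's inequality, by completing the square. *)
have h5 : (M + L) * t <= e / 2 * t ^+ 2 + (M + L) ^+ 2 / (2 * e).
  rewrite -subr_ge0 (_ : _ - _ = (e * t - (M + L)) ^+ 2 / (2 * e)).
    by rewrite divr_ge0 ?sqr_ge0 ?mulr_ge0 ?ltW.
  by field; rewrite gt_eqF.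
have h6 : `|(t, x) - q'| ^+ 2 <= k * sqdist (t, x) q'.
  by apply: (le_trans h4); rewrite ler_peMl// (le_trans _ h4)// sqr_ge0.
have := normr_ge0 ((t, x) - q'); move: h1 h2 h3 h5 h6.
move: (`|(t, x) - q'|) (k * _) (_ / (2 * e)) => d D E.
have : 0 <= (L - d / 2) ^+ 2 by exact: sqr_ge0.
have : 0 <= e * t by rewrite mulr_ge0// ltW.
have : 0 <= d ^+ 2 by exact: sqr_ge0.
move: (u _) (u _) (v _) (v _) (b * _) => u1 u2 v1 v2 B. nra.
Qed.

End ComparisonPrinciple.

(** * Maximum points of the doubled function and comparison *)

Section ComparisonTheorem.
Context {R : realType} {n : nat}.
Local Notation V := (R * 'rV[R]_n)%type.
Implicit Types (F : 'rV[R]_n * 'rV[R]_n -> R) (u v : V -> R).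

Lemma sqr_lt_bound (z B : R) : z ^+ 2 < B -> z < 1 + B.
Proof. nra. Qed.

(** The half-space is not compact, but the assumed bound confines the set where [Phi] exceeds [A], a
    value exceeded at [q1]; a maximum over large balls is then global. *)
Lemma doubling_max u v (A K e b k : R) (q1 : V) : 0 < e -> 0 < b -> 0 < K ->
  unif_continuous_on (@closed_halfspace R n) u ->
  unif_continuous_on (@closed_halfspace R n) v ->
  let Phi := fun q q' => u q - v q' - k * sqdist q q' - quad e e b 0 q in
  (forall q q', closed_halfspace q -> closed_halfspace q' ->
    Phi q q' <= A + K - e / 2 * q.1 ^+ 2 - `|q - q'| ^+ 2 / 4 - b * quad 0 0 1 0 q) ->
  closed_halfspace q1 -> A < Phi q1 q1 ->
  exists a c, [/\ closed_halfspace a, closed_halfspace c, Phi q1 q1 <= Phi a c &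
    forall q q', closed_halfspace q -> closed_halfspace q' -> Phi q q' <= Phi a c].
Proof.
move=> e0 b0 K0 uu vu Phi bound q10 q1A.
pose r := 2 + K / (e / 2) + K / b.
pose r' := r + (1 + K * 4).
have r0 : 0 <= r by rewrite !addr_ge0// divr_ge0// ltW//; lra.
have r'0 : 0 <= r' by rewrite /r'; lra.
have inside q q' : closed_halfspace q -> closed_halfspace q' -> A < Phi q q' ->
    `|q| <= r /\ `|q'| <= r'.
  move=> q0 q'0 Aq; have := bound q q' q0 q'0.
  have : 0 <= e / 2 * q.1 ^+ 2 by rewrite mulr_ge0 ?sqr_ge0//; lra.
  have : 0 <= `|q - q'| ^+ 2 by rewrite sqr_ge0.
  have h := sqr_norm_snd_le_quad q.
  have : b * `|q.2| ^+ 2 <= b * quad 0 0 1 0 q by rewrite ler_pM2l.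
  have : 0 <= b * `|q.2| ^+ 2 by rewrite mulr_ge0 ?sqr_ge0// ltW.
  move=> s1 s2 s3 s4 s5.
  have t1 : q.1 < 1 + K / (e / 2).
    by apply: sqr_lt_bound; rewrite ltr_pdivlMr; [rewrite mulrC; lra|lra].
  have t2 : `|q.2| < 1 + K / b.
    by apply: sqr_lt_bound; rewrite ltr_pdivlMr// mulrC; lra.
  have t3 : `|q - q'| < 1 + K * 4 by apply: sqr_lt_bound; lra.
  have qr : `|q| <= r.
    have Ke : 0 <= K / (e / 2) by rewrite divr_ge0//; lra.
    have Kb : 0 <= K / b by rewrite divr_ge0// ltW.
    rewrite prod_norm_le ger0_norm//; apply/andP; split; rewrite /r; lra.
  split => //; rewrite -(subrK q q'); apply: le_trans (ler_normD _ _) _.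
  by rewrite distrC /r'; lra.
pose Psi z := Phi (clamp z.1) (clamp z.2).
have Psic : continuous Psi by exact: doubling_continuous.
have [a [c [ar cr' acmax]]] := norm_ball_max2 r0 r'0 Psic.
have [q1r q1r'] := inside q1 q1 q10 q10 q1A.
have q1m : Phi q1 q1 <= Phi (clamp a) (clamp c).
  by have := acmax q1 q1 q1r q1r'; rewrite /Psi /= (clamp_id q10).
exists (clamp a), (clamp c); split; [exact: clamp_closed|exact: clamp_closed|by []|].
move=> q q' q0 q'0; case: (leP (Phi q q') A) => [le|lt].
  exact: le_trans le (le_trans (ltW q1A) q1m).
have [qr q'r'] := inside q q' q0 q'0 lt.
by have := acmax q q' qr q'r'; rewrite /Psi /= (clamp_id q0) (clamp_id q'0).
Qed.

(** Freezing one variable at the maximum point turns the penalties into a test function for the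
    other one; both inequalities then share the momentum [(2 * k) *: (a.2 - c.2)]. *)
Lemma doubling_test F u v (e b k : R) (a c : V) :
  viscosity_subsolution F u -> viscosity_supersolution F v ->
  open_halfspace a -> open_halfspace c ->
  (forall q q', closed_halfspace q -> closed_halfspace q' ->
      u q - v q' - k * sqdist q q' - quad e e b 0 q <=
      u a - v c - k * sqdist a c - quad e e b 0 a) ->
  2 * k * (a.1 - c.1) + (e + 2 * e * a.1) +
    F (a.2, (2 * k) *: (a.2 - c.2) + (2 * b) *: a.2) <= 0 /\
  0 <= 2 * k * (a.1 - c.1) + F (c.2, (2 * k) *: (a.2 - c.2)).
Proof.
move=> [_ us] [_ vs] apos cpos acmax; split.
  have d1 := @quad_differentiable R n 0 k k c a.
  have d2 := @quad_differentiable R n e e b 0 a.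
  have := us _ a (C1_testD (@C1_quad R n 0 k k c) (@C1_quad R n e e b 0)) apos.
  rewrite dtD// DxD// !dt_quad !Dx_quad /= !subr0 add0r; apply.
  apply: filterS (near_open_halfspace apos) => q /ltW q0.
  by have := acmax q c q0 (ltW cpos); rewrite !quad_sqdist; lra.
have d1 := @quad_differentiable R n 0 k k a c.
have := vs _ c (C1_testN (@C1_quad R n 0 k k a)) cpos.
rewrite dtN// DxN// dt_quad Dx_quad -scalerN opprB => H.
suff /H : local_min (fun q => v q - - quad 0 k k a q) c by lra.
apply: filterS (near_open_halfspace cpos) => q /ltW q0.
have := acmax a q (ltW apos) q0; rewrite !quad_sqdist (sqdistC q) (sqdistC c); lra.
Qed.

(** The last hypothesis on [sqdist] comes from comparing the maximum with its value at [(a, a)],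
    where the terms in [u] cancel. The conclusion is a momentum bound uniform in [k]. *)
Lemma doubling_dist v (L k : R) (a c : V) : 0 <= k ->
  0 <= L -> `|v a - v c| <= L * `|a - c| -> k * sqdist a c <= v a - v c ->
  k * `|a - c| <= L.
Proof.
move=> k0 L0 h2 h1; have h3 := ler_norm (v a - v c).
have h5 : k * `|a - c| ^+ 2 <= L * `|a - c|.
  apply: (@le_trans _ _ (k * sqdist a c)); last by lra.
  by rewrite ler_wpM2l// sqr_norm_le_sqdist.
have [->|ac0] := eqVneq `|a - c| 0; first by rewrite mulr0.
by rewrite -(@ler_pM2r _ `|a - c|) ?lt_def ?ac0//= -mulrA -expr2.
Qed.

(** The point may escape like [sqrt (K / b)], yet the gradient of the penalty is of order
    [sqrt (b * K)]. *)
Lemma penalty_gradient (b K m : R) (a : V) : 0 < b -> 0 < m ->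
  b * (4 * K) < m ^+ 2 -> b * quad 0 0 1 0 a <= K -> `|(2 * b) *: a.2| < m.
Proof.
move=> b0 m0 h3 bS; rewrite normrZ ger0_norm; last by rewrite mulr_ge0// ltW.
rewrite ltNge; apply/negP => mb.
have h1 : m ^+ 2 <= (2 * b * `|a.2|) ^+ 2.
  by rewrite lerXn2r ?nnegrE ?mulr_ge0// ltW.
have h2 : b * `|a.2| ^+ 2 <= K.
  by apply: le_trans bS; rewrite ler_pM2l// sqr_norm_snd_le_quad.
have : (2 * b * `|a.2|) ^+ 2 = 4 * b * (b * `|a.2| ^+ 2) by ring.
have : 4 * b * (b * `|a.2| ^+ 2) <= 4 * b * K by rewrite ler_wpM2l// mulr_ge0// ltW.
lra.
Qed.

Lemma doubling_momentum (k L : R) (a c : V) : 0 <= k -> k * `|a - c| <= L ->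
  `|(2 * k) *: (a.2 - c.2)| <= 2 * L.
Proof.
move=> k0 kac; rewrite normrZ ger0_norm; last by rewrite mulr_ge0.
have := ler_wpM2l k0 (norm_snd_le (a - c)); rewrite /=; lra.
Qed.

(** Subtracting the two inequalities leaves [e + 2 * e * t] below an increment of [F] that is
    smaller than [e]. *)
Lemma doubling_absurd F (B e d s t : R) (x y p z : 'rV[R]_n) : 0 < e -> 0 <= t ->
  (forall x y p p', `|p| <= B + 1 -> `|p'| <= B + 1 -> `|x - y| < d ->
    `|p - p'| < d -> `|F (x, p) - F (y, p')| < e) ->
  `|p| <= B -> `|z| < 1 -> `|z| < d -> `|x - y| < d ->
  s + (e + 2 * e * t) + F (x, p + z) <= 0 -> 0 <= s + F (y, p) -> False.
Proof.
move=> e0 t0 FP pB z1 zd xy hu hv.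
have pzB : `|p + z| <= B + 1.
  by apply: le_trans (ler_normD _ _) _; exact: lerD pB (ltW z1).
have pB1 : `|p| <= B + 1 by lra.
have := FP y x p (p + z) pB1 pzB; rewrite distrC => /(_ xy).
rewrite opprD addrA subrr sub0r normrN => /(_ zd)/ltr_normlP[_].
have := mulr_ge0 (ltW e0) t0; lra.
Qed.

Lemma comparison F u v (A L : R) : ham_uc F -> 0 <= L ->
  viscosity_subsolution F u -> viscosity_supersolution F v ->
  unif_continuous_on (@closed_halfspace R n) u ->
  (forall q q', closed_halfspace q -> closed_halfspace q' ->
    `|v q - v q'| <= L * `|q - q'|) ->
  (forall x, u (0, x) <= v (0, x) + A) ->
  forall q, closed_halfspace q -> u q <= v q + A.
Proof.
move=> Fuc L0 us vs uu vL uvA q1 q10; rewrite leNgt; apply/negP => gap.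
have vu := lipschitz_clamp_continuous L0 vL.
have [M M0 uM] : exists2 M, 0 <= M & forall q q', closed_halfspace q ->
    closed_halfspace q' -> `|u q - u q'| <= 1 + M * `|q - q'|.
  move/uconP_norm: (uu) => /(_ 1 ltr01)[d d0 dP]; exists (1 / d).
    by rewrite divr_ge0// ltW.
  exact: (linear_growth (@closed_halfspace_convex R n) ltr01 d0 dP).
(* The time and space penalties at [q1] cost at most [s] each; the remaining [2 * s] keep the
   maximum point off the initial time. *)
pose s := (u q1 - v q1 - A) / 4.
have s0 : 0 < s by rewrite /s divr_gt0//; lra.
have t10 : 0 <= q1.1 by [].
pose e := s / (q1.1 + q1.1 ^+ 2 + 1).
have den0 : 0 < q1.1 + q1.1 ^+ 2 + 1 by have := sqr_ge0 q1.1; lra.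
have e0 : 0 < e by rewrite divr_gt0.
pose K := 1 + L ^+ 2 + (M + L) ^+ 2 / (2 * e).
have K0 : 0 < K.
  have := sqr_ge0 L; have : 0 <= (M + L) ^+ 2 / (2 * e).
    by rewrite divr_ge0 ?sqr_ge0// mulr_ge0// ltW.
  by rewrite /K; lra.
have [dF dF0 dFP] := Fuc (2 * L + 1) e e0.
have [m [m0 m1 mdF _]] := pick_below ltr01 dF0 ltr01.
have S0 : 0 <= quad 0 0 1 0 q1.
  exact: le_trans (sqr_ge0 _) (sqr_norm_snd_le_quad q1).
(* [b] makes the space penalty at [q1] less than [s] and, by [penalty_gradient], its gradient at the
   maximum less than [m]. It may depend on [K], which does not depend on it. *)
have [b [b0 bs bm _]] := pick_below (divr_gt0 s0 (ltr_wpDl S0 ltr01))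
  (divr_gt0 (exprn_gt0 2 m0) (mulr_gt0 (ltr0n _ 4) K0)) ltr01.
move/uconP_norm: (uu) => /(_ s s0)[du du0 duP].
have [w [w0 w1 w2 w3]] := pick_below dF0 du0 (divr_gt0 s0 (ltr_wpDl L0 ltr01)).
(* Chosen so that [k * |a - c| <= L] forces [|a - c| <= w]. *)
pose k := 1 + L / w.
have Lw : 0 <= L / w by rewrite divr_ge0// ltW.
have k1 : 1 <= k by rewrite /k; lra.
have kw : L <= k * w by rewrite /k mulrDl divfK ?gt_eqF//; lra.
have bound := doubling_bound b L0 M0 e0 k1 uM vL uvA.
have [a [c [a0 c0 big acmax]]] : exists a c,
    [/\ closed_halfspace a, closed_halfspace c,
      A + 2 * s <= u a - v c - k * sqdist a c - quad e e b 0 a &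
      forall q q', closed_halfspace q -> closed_halfspace q' ->
      u q - v q' - k * sqdist q q' - quad e e b 0 q <=
      u a - v c - k * sqdist a c - quad e e b 0 a].
  have q1val : A + 2 * s <= u q1 - v q1 - k * sqdist q1 q1 - quad e e b 0 q1.
    rewrite sqdistxx mulr0 subr0 quad_penalty.
    have h1 : e * (q1.1 + q1.1 ^+ 2 + 1) = s by rewrite /e divfK// gt_eqF.
    have h2 : b * (quad 0 0 1 0 q1 + 1) < s by rewrite -ltr_pdivlMr// ltr_wpDl.
    have h3 : 4 * s = u q1 - v q1 - A by rewrite /s mulrC divfK.
    move: h1 h2 h3; move: (quad _ _ _ _ _) => Q; nra.
  have q1A : A < u q1 - v q1 - k * sqdist q1 q1 - quad e e b 0 q1 by lra.
  have [a [c [? ? ? ?]]] := doubling_max e0 b0 K0 uu vu bound q10 q1A.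
  by exists a, c; split => //; lra.
have k0 : 0 <= k by exact: le_trans ler01 k1.
have kac : k * `|a - c| <= L.
  apply: (doubling_dist k0 L0 (vL a c a0 c0)).
  by have := acmax a a a0 a0; rewrite sqdistxx mulr0 subr0; clear; lra.
have acw : `|a - c| <= w.
  by rewrite -(@ler_pM2l _ k); [exact: le_trans kac kw|lra].
have Lws : L * `|a - c| < s.
  have := w3; rewrite ltr_pdivlMr ?ltr_wpDl// => h.
  have : L * `|a - c| <= L * w by rewrite ler_wpM2l.
  lra.
have vac : v a - v c < s.
  by have := vL a c a0 c0; have := ler_norm (v a - v c); lra.
have D0 : 0 <= k * sqdist a c.
  exact: mulr_ge0 k0 (le_trans (sqr_ge0 _) (sqr_norm_le_sqdist a c)).
have P0 : 0 <= quad e e b 0 a.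
  rewrite quad_penalty; have := mulr_ge0 (ltW e0) (a0 : 0 <= a.1).
  have := mulr_ge0 (ltW e0) (sqr_ge0 a.1).
  have := mulr_ge0 (ltW b0) (le_trans (sqr_ge0 _) (sqr_norm_snd_le_quad a)).
  lra.
have apos : open_halfspace a.
  rewrite /open_halfspace /= lt_neqAle (a0 : 0 <= a.1) andbT; apply/eqP => a10.
  have aE : a = (0, a.2) by rewrite a10 -surjective_pairing.
  have := uvA a.2; rewrite -aE; lra.
(* If [c] had time 0, then [a] would be within [w] of the initial time; moving [u] from [a] to
   [(0, a.2)] and [v] from there to [c] costs less than [s] each. *)
have cpos : open_halfspace c.
  rewrite /open_halfspace /= lt_neqAle (c0 : 0 <= c.1) andbT; apply/eqP => c10.
  have z0 : closed_halfspace ((0, a.2) : V) by rewrite /closed_halfspace /=.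
  have cE : c = (0, c.2) by rewrite c10 -surjective_pairing.
  have h1 : `|a - (0, a.2)| < du.
    apply: le_lt_trans _ w2; apply: le_trans acw.
    rewrite prod_norm_le /= subrr normr0 normr_ge0 andbT.
    by have := norm_fst_le (a - c); rewrite /= -c10.
  have h2 : `|(0, a.2) - c| <= `|a - c|.
    rewrite prod_norm_le /= -c10 subrr normr0 normr_ge0 /=.
    exact: norm_snd_le (a - c).
  have h3 := duP _ _ a0 z0 h1; have h4 := ler_norm (u a - u (0, a.2)).
  have h5 := vL _ _ z0 c0; have h6 := ler_norm (v (0, a.2) - v c).
  have h7 := uvA a.2.
  have : L * `|(0, a.2) - c| <= L * `|a - c| by rewrite ler_wpM2l.
  lra.
have [hu hv] := doubling_test us vs apos cpos acmax.
have bS : b * quad 0 0 1 0 a <= K.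
  have := bound a c a0 c0; rewrite -/K.
  have : 0 <= e / 2 * a.1 ^+ 2 by rewrite mulr_ge0 ?sqr_ge0//; lra.
  have : 0 <= `|a - c| ^+ 2 by rewrite sqr_ge0.
  lra.
have pb : `|(2 * b) *: a.2| < m.
  by apply: penalty_gradient bS => //; rewrite -ltr_pdivlMr// mulr_gt0.
have pa := doubling_momentum k0 kac.
apply: (doubling_absurd e0 a0 dFP pa (lt_trans pb m1) (lt_trans pb mdF) _ hu hv).
exact: le_lt_trans (le_trans (norm_snd_le (a - c)) acw) w1.
Qed.

End ComparisonTheorem.

(** * Perron's method for Lipschitz initial data *)

Section Bump.
Context {R : realType} {n : nat}.
Local Notation V := (R * 'rV[R]_n)%type.
Implicit Types (F : 'rV[R]_n * 'rV[R]_n -> R) (u v w phi psi : V -> R) (q z : V).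

Lemma local_max_derive_ge w psi q z (c r : R) :
  differentiable psi q -> local_max (fun q' => w q' - psi q') q -> 0 < r ->
  (forall s, 0 < s -> s < r -> c * s <= w (q + s *: z) - w q) ->
  c <= 'D_z psi q.
Proof.
move=> dpsi /nearP_norm[r1 r10 qmax] r0 H.
have N0 : 0 < `|z| + 1 by rewrite ltr_wpDl.
have [r2 [r20 r2r r2r1 _]] := pick_below r0 (divr_gt0 r10 N0) ltr01.
apply: (derive_ge (r := r2)) => // s s0 sr.
have := H s s0 (lt_trans sr r2r).
have := qmax (q + s *: z); rewrite addrAC subrr add0r normrZ gtr0_norm//.
have sr1 : s * `|z| < r1.
  have : s * (`|z| + 1) < r1 by rewrite -ltr_pdivlMr//; exact: lt_trans sr r2r1.
  lra.
by move=> /(_ sr1); lra.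
Qed.

Definition ell (a : R) (p : 'rV[R]_n) z : R :=
  a * z.1 + \sum_(i < n) p ord0 i * z.2 ord0 i.

Lemma ellD a p z z' : ell a p (z + z') = ell a p z + ell a p z'.
Proof.
rewrite /ell /= mulrDr addrACA -big_split /=; congr (_ + _).
by apply: eq_bigr => i _; rewrite !mxE mulrDr.
Qed.

Lemma ellZ a p (s : R) z : ell a p (s *: z) = s * ell a p z.
Proof.
rewrite /ell /= mulrDr mulr_sumr -[s *: z.1]/(s * z.1); congr (_ + _); first by ring.
by apply: eq_bigr => i _; rewrite !mxE; ring.
Qed.

Lemma ellN a p z : ell a p (- z) = - ell a p z.
Proof. by rewrite -scaleN1r ellZ mulN1r. Qed.

Lemma ell_time a p : ell a p (1, 0) = a.
Proof. by rewrite /ell /= mulr1 big1 ?addr0// => i _; rewrite mxE mulr0. Qed.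

Lemma ell_space a p i : ell a p (0, delta_mx ord0 i) = p ord0 i.
Proof.
rewrite /ell /= mulr0 add0r (bigD1 i)//= mxE !eqxx mulr1 big1 ?addr0// => j ji.
by rewrite mxE (negbTE ji) andbF mulr0.
Qed.

Lemma diff_ell phi q z : differentiable phi q ->
  'd phi q z = ell (dt phi q) (Dx phi q) z :> R.
Proof.
move=> dphi.
have zE : z = z.1 *: ((1, 0) : V) + \sum_(i < n) z.2 ord0 i *: ((0, delta_mx ord0 i) : V).
  rewrite [LHS]surjective_pairing [in RHS](surjective_pairing (\sum_(i < n) _)).
  rewrite [z.2 in LHS]row_sum_delta; congr (_, _).
    rewrite /= -[z.1 *: 1]/(z.1 * 1) mulr1 (raddf_sum fst)/= big1 ?addr0// => i _.
    exact: scaler0.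
  by rewrite /= scaler0 add0r (raddf_sum snd).
rewrite [in LHS]zE linearD linearZ linear_sum /ell /dt deriveE//; congr (_ + _).
  by rewrite mulrC.
apply: eq_bigr => i _; rewrite linearZ /= mxE deriveE// mulrC.
by [].
Qed.

Lemma norm_time : `|((1, 0) : V)| = 1.
Proof. by rewrite prod_normE /= normr0 normr1 max_l. Qed.

Lemma norm_delta_le i : `|((0, delta_mx ord0 i) : V)| <= 1.
Proof.
rewrite prod_norm_le /= normr0 ler01 /=; apply: norm_le_coord => // j.
by rewrite mxE eqxx; case: (j == i); rewrite /= ?normr0 ?normr1.
Qed.

(** The dual of the sup norm is the l1 norm, hence the factor [n]; it reappears in the lower bound
    [n%:R * L0 + 1] for [L]. *)
Lemma ell_le a p (c : R) (z : 'rV[R]_n) : `|p| <= c ->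
  `|ell a p (0, z)| <= n%:R * c * `|z|.
Proof.
move=> pc; rewrite /ell /= mulr0 add0r; apply: le_trans (ler_norm_sum _ _ _) _.
have -> : n%:R * c * `|z| = \sum_(i < n) c * `|z|.
  by rewrite sumr_const card_ord -mulrA mulr_natl.
apply: ler_sum => i _; rewrite normrM ler_pM//; last exact: coord_le_norm.
exact: le_trans (coord_le_norm _ _) pc.
Qed.

Definition cone (k : R) a p (th : R) q0 q : R :=
  k + ell a p (q - q0) - th * `|q - q0|.

Lemma cone_dir k a p th q0 q z (s : R) : 0 <= th -> 0 <= s ->
  `|cone k a p th q0 (q + s *: z) - cone k a p th q0 q - s * ell a p z| <=
    th * `|z| * s.
Proof.
move=> th0 s0; rewrite /cone (_ : q + s *: z - q0 = (q - q0) + s *: z); last first.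
  by rewrite addrAC.
rewrite ellD ellZ.
have : `| `|q - q0 + s *: z| - `|q - q0| | <= s * `|z|.
  apply: le_trans (ler_dist_dist _ _) _.
  by rewrite addrAC subrr add0r normrZ ger0_norm.
move: (`|q - q0 + _|) (`|q - q0|) (ell _ _ _) (ell _ _ _) => A B e1 e2.
rewrite !ler_norml => /andP[h1 h2]; apply/andP.
have := ler_wpM2l th0 h1; have := ler_wpM2l th0 h2; split; lra.
Qed.

Lemma ell_bound a p z : `|ell a p z| <= (`|a| + n%:R * `|p|) * `|z|.
Proof.
have -> : ell a p z = a * z.1 + ell a p (0, z.2) by rewrite /ell /= mulr0 add0r.
apply: le_trans (ler_normD _ _) _; rewrite mulrDl lerD//.
  by rewrite normrM ler_wpM2l// norm_fst_le.
apply: le_trans (ell_le a z.2 (lexx `|p|)) _.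
by rewrite ler_wpM2l ?mulr_ge0// norm_snd_le.
Qed.

Lemma cone_continuous k a p th q0 : 0 <= th -> continuous (cone k a p th q0).
Proof.
move=> th0 q; apply/contP_norm => e e0.
pose B := `|a| + n%:R * `|p| + th + 1.
have B0 : 0 < B by rewrite ltr_wpDl// !addr_ge0// mulr_ge0.
exists (e / B); first exact: divr_gt0.
move=> q'; rewrite ltr_pdivlMr// => q'q.
have := cone_dir k a p q0 q (q' - q) th0 ler01.
rewrite scale1r mul1r mulr1 (addrC q) subrK => h1.
rewrite -[X in `|X|](subrK (ell a p (q' - q))).
apply: le_lt_trans (ler_normD _ _) _; apply: le_lt_trans q'q.
have := ell_bound a p (q' - q); have := normr_ge0 (q' - q); rewrite /B; lra.
Qed.

(** Along any unit direction the slope of the cone differs from that of [ell a p] by at most [th].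
    Applying this to [z] and [- z] covers the vertex and the ridges, where the cone is not
    differentiable. *)
Lemma cone_test k a p th q0 q psi : 0 <= th -> differentiable psi q ->
  local_max (fun q' => cone k a p th q0 q' - psi q') q ->
  `|dt psi q - a| <= th /\ `|Dx psi q - p| <= th.
Proof.
move=> th0 dpsi qmax.
have dir z : `|z| <= 1 -> ell a p z - th <= 'D_z psi q.
  move=> z1; apply: (local_max_derive_ge (r := 1) dpsi qmax) => // s s0 _.
  have := cone_dir k a p q0 q z th0 (ltW s0); rewrite ler_norml => /andP[].
  have : th * `|z| * s <= th * s by apply: ler_wpM2r; [exact: ltW|exact: ler_piMr].
  lra.
have dir2 z : `|z| <= 1 -> `|'D_z psi q - ell a p z| <= th.
  move=> z1; have := dir z z1; have := dir (- z); rewrite normrN => /(_ z1).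
  rewrite deriveNv// ellN ler_norml => h1 h2; apply/andP; split; lra.
split.
  by have := dir2 (1, 0); rewrite ell_time; apply; rewrite norm_time.
apply: norm_le_coord => // i; rewrite !mxE.
by have := dir2 _ (norm_delta_le i); rewrite ell_space.
Qed.

(* With [b] a cone, [raise] is the bump construction of Perron's method.  A cone
   is strictly below [u] away from its vertex by mere differentiability of the
   test function, and its Lipschitz constants are explicit. *)
Definition raise (u b : V -> R) q0 (r : R) q : R :=
  if `|q - q0| < r then Num.max (u q) (b q) else u q.

Section Raise.
Variables (u b : V -> R) (q0 : V) (r : R).
Hypothesis r_gt0 : 0 < r.
Hypothesis r_time : r < q0.1.
Hypothesis b_le_u : forall q, r / 4 <= `|q - q0| -> `|q - q0| < r -> b q <= u q.

Lemma raise_ge q : u q <= raise u b q0 r q.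
Proof. by rewrite /raise; case: ifP => // _; rewrite le_max lexx. Qed.

Lemma raise_ge_b q : `|q - q0| < r -> b q <= raise u b q0 r q.
Proof. by rewrite /raise => ->; rewrite le_max lexx orbT. Qed.

Lemma raise_out q : r / 4 <= `|q - q0| -> raise u b q0 r q = u q.
Proof. by move=> h; rewrite /raise; case: ifP => // h2; rewrite max_l// b_le_u. Qed.

Lemma raise_cases q : raise u b q0 r q = u q \/
  [/\ raise u b q0 r q = b q, `|q - q0| < r / 4 & u q < b q].
Proof.
case: (leP (r / 4) `|q - q0|) => h; first by left; exact: raise_out.
rewrite /raise; case: ifP => h2; last by left.
by case: (leP (b q) (u q)) => h3; [left|right; split].
Qed.

Lemma near_closed q : `|q - q0| < r -> closed_halfspace q.
Proof.
move=> h; have : `|q - q0| < q0.1 by exact: lt_trans h r_time.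
by move=> /ball_open_halfspace; exact: ltW.
Qed.

(* If the segment leaves the ball, cut it inside the annulus where [raise]
   agrees with [u]. *)
Lemma raise_dir z (k : R) :
  (forall q s, 0 <= s -> closed_halfspace q -> closed_halfspace (q + s *: z) ->
    u q - u (q + s *: z) <= k * s) ->
  (forall q s, 0 <= s -> b q - b (q + s *: z) <= k * s) ->
  forall q s, 0 <= s -> closed_halfspace q -> closed_halfspace (q + s *: z) ->
    raise u b q0 r q - raise u b q0 r (q + s *: z) <= k * s.
Proof.
move=> uk bk q s s0 qc qsc; have r0 := r_gt0.
have [->|[-> qr qub]] := raise_cases q.
  have := raise_ge (q + s *: z); have := uk q s s0 qc qsc; lra.
have [h|h] := ltP `|q + s *: z - q0| r.
  have := raise_ge_b h; have := bk q s s0; lra.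
have sz : 3 / 4 * r <= s * `|z|.
  have : `|q + s *: z - q0| <= `|q - q0| + s * `|z|.
    by rewrite addrAC; apply: le_trans (ler_normD _ _) _; rewrite normrZ ger0_norm.
  lra.
have z0 : 0 < `|z|.
  by rewrite lt_def normr_ge0 andbT; apply/eqP => z0; move: sz; rewrite z0 mulr0; lra.
(* A displacement of length [r / 2] from a point of the ball of radius [r / 4] ends between radii
   [r / 4] and [3 * r / 4]. *)
pose s' := r / 2 / `|z|.
have s'z : s' * `|z| = r / 2 by rewrite /s' divfK// gt_eqF.
have s'0 : 0 <= s' by rewrite /s' divr_ge0//; lra.
have s's : s' <= s by rewrite -(ler_pM2r z0); lra.
pose y := q + s' *: z.
have yq : `|y - q| = r / 2 by rewrite /y addrAC subrr add0r normrZ ger0_norm.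
have yr1 : `|y - q0| < r.
  have := ler_distD q y q0; rewrite yq; lra.
have yr2 : r / 4 <= `|y - q0|.
  have := ler_distD q0 y q; rewrite yq (distrC q0); lra.
have h1 := bk q s' s'0; have h2 := b_le_u yr2 yr1.
have h3 : u y - u (q + s *: z) <= k * (s - s').
  have := uk y (s - s'); rewrite /y -addrA -scalerDl addrC.
  rewrite [s' + _]addrC subrK addrC => H; apply: H => //; first by rewrite subr_ge0.
  exact: near_closed yr1.
have := raise_ge (q + s *: z); rewrite -/y in h1; lra.
Qed.

Lemma raise_continuous q : {for q, continuous u} -> {for q, continuous b} ->
  {for q, continuous (raise u b q0 r)}.
Proof.
move=> uc bc; have r0 := r_gt0; have [h|h] := ltP `|q - q0| r.
  apply: (eq_near_continuous (g := fun q => Num.max (u q) (b q))).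
    apply/nearP_norm; exists (r - `|q - q0|); first by rewrite subr_gt0.
    move=> q' q'q; rewrite /raise ifT//.
    by have := ler_distD q q' q0; lra.
  exact: continuous_max.
apply: (eq_near_continuous (g := u)) => //.
apply/nearP_norm; exists (r / 2); first by rewrite divr_gt0.
move=> q' q'q; apply: raise_out.
by have := ler_distD q' q q0; rewrite (distrC q q'); lra.
Qed.

Lemma raise_sub F : viscosity_subsolution F u ->
  (forall q, {for q, continuous b}) ->
  (forall psi q, C1_test psi -> open_halfspace q -> `|q - q0| < r ->
     local_max (fun q' => b q' - psi q') q ->
     dt psi q + F (q.2, Dx psi q) <= 0) ->
  viscosity_subsolution F (raise u b q0 r).
Proof.
move=> [uc us] bc bs; have r0 := r_gt0; split.
  by move=> q q_gt0; apply: raise_continuous; [exact: uc|exact: bc].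
move=> psi q psi1 q_gt0 /nearP_norm[d d0 qmax].
have [E|[E qr _]] := raise_cases q.
  apply: us => //; apply/nearP_norm; exists d => // q' /qmax.
  by rewrite E; have := raise_ge q'; lra.
have qr' : `|q - q0| < r by lra.
apply: bs => //; apply/nearP_norm; exists (Num.min d (r - `|q - q0|)).
  by rewrite lt_min d0 subr_gt0.
move=> q'; rewrite lt_min => /andP[/qmax h h'].
have /raise_ge_b : `|q' - q0| < r by have := ler_distD q q' q0; lra.
by move: h; rewrite E; lra.
Qed.

End Raise.

End Bump.

(** * The Perron class and its supremum *)

Section Perron.
Context {R : realType} {n : nat}.
Local Notation V := (R * 'rV[R]_n)%type.
Variables (F : 'rV[R]_n * 'rV[R]_n -> R) (u0 : 'rV[R]_n -> R) (C G L0 L : R).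
Implicit Types (u v w phi psi : V -> R) (q z : V).
Hypothesis Fcont : continuous F.
Hypothesis C_ge0 : 0 <= C.
Hypothesis G_ge0 : 0 <= G.
Hypothesis G_le_L : G <= L.
Hypothesis L0_lt_L : n%:R * L0 + 1 <= L.
Hypothesis u0_lip : forall x y, `|u0 x - u0 y| <= G * `|x - y|.
Hypothesis F_le_C : forall x p, `|p| <= G -> F (x, p) <= C.
Hypothesis F_ge_C : forall x p, - C <= F (x, p).
Hypothesis F_coercive : forall x p, L0 <= `|p| -> C <= F (x, p).

(* Only the upper time slope is constrained: raising a function by a cone of
   time slope less than [C] preserves that bound but may destroy a lower one.
   The lower bound is recovered for the supremum, since [delay] preserves the
   class. *)
Record perron_class (v : V -> R) : Prop := PerronClass {
  pc_sub : viscosity_subsolution F v;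
  pc_init : forall x, v (0, x) = u0 x;
  pc_low : forall t x, 0 <= t -> u0 x - C * t <= v (t, x);
  pc_time : forall t h x, 0 <= t -> 0 <= h -> v (t + h, x) <= v (t, x) + C * h;
  pc_space : forall t x y, 0 <= t -> v (t, x) - v (t, y) <= L * `|x - y| }.

Lemma pc_up v t x : perron_class v -> 0 <= t -> v (t, x) <= u0 x + C * t.
Proof.
by move=> vS t0; rewrite -(pc_init vS) -{1}[t]add0r; exact: (pc_time vS).
Qed.

Lemma u0_lip1 x y : u0 x - u0 y <= G * `|x - y|.
Proof. exact: le_trans (ler_norm _) (u0_lip x y). Qed.

Lemma u0_continuous : continuous u0.
Proof.
move=> x; apply/contP_norm => e e0; have g0 : 0 < G + 1 by rewrite ltr_wpDl.
exists (e / (G + 1)); first exact: divr_gt0.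
move=> y; rewrite ltr_pdivlMr// => xy; apply: le_lt_trans (u0_lip _ _) _.
by have := normr_ge0 (y - x); lra.
Qed.

Definition base q : R := u0 q.2 - C * q.1.

Lemma base_continuous : continuous base.
Proof.
move=> q; apply: cvgB.
  by apply: continuous_comp; [exact: cvg_snd|exact: u0_continuous].
by apply: cvgM; [exact: cvg_cst|exact: cvg_fst].
Qed.

(** Only backward time and spatial increments at time [q.1] are used: they give [dt psi q <= - C]
    and a gradient bounded by [G]. Agreement with [base] up to time [q.1] therefore suffices, which
    also covers [delay] at its junction. *)
Lemma base_test w psi q : differentiable psi q ->
  local_max (fun q' => w q' - psi q') q ->
  (forall q', q'.1 <= q.1 -> w q' = base q') ->
  dt psi q + F (q.2, Dx psi q) <= 0.
Proof.
move=> dpsi qmax wb.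
have h1 : C <= 'D_(- ((1, 0) : V)) psi q.
  apply: (local_max_derive_ge (r := 1) dpsi qmax) => // s s0 _.
  rewrite !wb//; last by rewrite /= -[s *: _]/(s * -1); lra.
  by rewrite /base /= oppr0 scaler0 addr0 -[s *: _]/(s * -1); lra.
have h2 z : `|z| <= 1 -> z.1 = 0 -> - G <= 'D_z psi q.
  case: z => t z; rewrite prod_norm_le => /andP[_ /= z1] ->.
  apply: (local_max_derive_ge (r := 1) dpsi qmax) => // s s0 _.
  rewrite !wb//=; last by rewrite scaler0 addr0.
  have := u0_lip1 q.2 (q.2 + s *: z).
  rewrite opprD addrA subrr sub0r normrN normrZ gtr0_norm// /base /= scaler0 addr0.
  have : G * (s * `|z|) <= G * s.
    by apply: ler_wpM2l => //; apply: ler_piMr => //; exact: ltW.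
  lra.
have h3 : `|Dx psi q| <= G.
  apply: norm_le_coord => // i; rewrite mxE ler_norml.
  have e1 := norm_delta_le (R := R) i.
  have := h2 _ e1 erefl; have := h2 (- (0, delta_mx ord0 i)).
  rewrite normrN deriveNv// => /(_ e1) /=; rewrite oppr0 => /(_ erefl).
  by move=> ? ?; apply/andP; split; lra.
by move: h1; rewrite deriveNv// -/(dt psi q); have := F_le_C q.2 h3; lra.
Qed.

Lemma base_class : perron_class base.
Proof.
split.
- split; first by move=> q _; exact: base_continuous.
  move=> psi q psi1 q0 qmax; have [dpsi _ _] := psi1 q q0.
  exact: (base_test dpsi qmax).
- by move=> x; rewrite /base /= mulr0 subr0.
- by [].
- by move=> t h x t0 h0; rewrite /base /=; have := mulr_ge0 C_ge0 h0; lra.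
- move=> t x y t0; rewrite /base /=; have := u0_lip1 x y.
  have : G * `|x - y| <= L * `|x - y| by rewrite ler_wpM2r.
  lra.
Qed.

Definition delay (h : R) v q : R :=
  if q.1 <= h then base q else v (q - (h, 0)) - C * h.

(** Supplies continuity across the junction, where the two branches meet. *)
Lemma delay_near h v q : perron_class v -> 0 <= q.1 ->
  `|delay h v q - (u0 q.2 - C * h)| <= C * `|q.1 - h|.
Proof.
move=> vS q0; rewrite /delay; case: (leP q.1 h) => qh.
  rewrite /base (_ : _ - _ = C * (h - q.1)); last by ring.
  by rewrite normrM (ger0_norm C_ge0) distrC.
have qh0 : 0 <= q.1 - h by lra.
have -> : q - (h, 0) = (q.1 - h, q.2) :> V by rewrite [LHS]surjective_pairing /= subr0.
have := pc_low vS q.2 qh0; have := pc_up q.2 vS qh0.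
by rewrite (ger0_norm qh0) ler_norml => ? ?; apply/andP; split; lra.
Qed.

Lemma delay_continuous h v q : perron_class v -> open_halfspace q ->
  {for q, continuous (delay h v)}.
Proof.
move=> vS q0; have [[vc _] _ _ _ _] := vS.
case: (ltgtP q.1 h) => qh.
- apply: (eq_near_continuous (g := base)); last exact: base_continuous.
  apply/nearP_norm; exists (h - q.1); first by rewrite subr_gt0.
  move=> q' q'q; rewrite /delay ifT//.
  by have := ler_norm (q' - q).1; have := norm_fst_le (q' - q); rewrite /=; lra.
- apply: (eq_near_continuous (g := fun q' => v (q' + - (h, 0)) - C * h)).
    apply/nearP_norm; exists (q.1 - h); first by rewrite subr_gt0.
    move=> q' q'q; rewrite /delay ifF//; apply/negbTE; rewrite -ltNge.
    have := ler_norm (- (q' - q).1); rewrite normrN.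
    by have := norm_fst_le (q' - q); rewrite /=; lra.
  apply: cvgB; last exact: cvg_cst.
  apply: continuous_shift; apply: vc; rewrite /open_halfspace /=.
  by rewrite subr_gt0.
- apply/contP_norm => e e0; have CG : 0 < C + G + 1 by have := C_ge0; have := G_ge0; lra.
  have [d [d0 dq de _]] := pick_below q0 (divr_gt0 e0 CG) ltr01.
  exists d => // q' q'q.
  have q'0 : open_halfspace q' by apply: ball_open_halfspace (lt_trans q'q dq).
  have h1 := delay_near h vS (ltW q'0).
  have h2 : delay h v q = u0 q.2 - C * h by rewrite /delay qh lexx /base qh.
  have h3 := u0_lip q'.2 q.2.
  have h4 : C * `|q'.1 - h| <= C * `|q' - q|.
    by rewrite ler_wpM2l// -qh; exact: norm_fst_le (q' - q).
  have h5 : G * `|q'.2 - q.2| <= G * `|q' - q|.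
    by rewrite ler_wpM2l//; exact: norm_snd_le (q' - q).
  have h6 : (C + G + 1) * `|q' - q| < e.
    by rewrite mulrC -ltr_pdivlMr//; exact: lt_trans q'q de.
  rewrite h2 (_ : _ - _ = (delay h v q' - (u0 q'.2 - C * h)) + (u0 q'.2 - u0 q.2)).
    apply: le_lt_trans (ler_normD _ _) _.
    by have := normr_ge0 (q' - q); lra.
  ring.
Qed.

Lemma delay_class h v : 0 <= h -> perron_class v -> perron_class (delay h v).
Proof.
move=> h0 vS; have [[vc vs] vi vl vt vx] := vS; have C0 := C_ge0.
have E t x : ((t, x) : V) - (h, 0) = (t - h, x) by rewrite [LHS]surjective_pairing /= subr0.
split.
- split; first by move=> q q0; exact: delay_continuous.
  move=> psi q psi1 q0 qmax; have [dpsi _ _] := psi1 q q0.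
  have [qh|qh] := leP q.1 h.
    apply: (base_test dpsi qmax) => q' q'q.
    by rewrite /delay (le_trans q'q qh).
  have q0' : open_halfspace (q - (h, 0)) by rewrite /open_halfspace /= subr_gt0.
  have := vs _ _ (C1_test_shift h0 psi1) q0'.
  rewrite dt_shift Dx_shift subrK /= subr0; apply.
  move/nearP_norm: qmax => [r r0 rP].
  have qh' : 0 < q.1 - h by rewrite subr_gt0.
  have [d [d0 dr dh _]] := pick_below r0 qh' ltr01.
  apply/nearP_norm; exists d => // q' q'd.
  have E1 : q' - (q - (h, 0)) = q' + (h, 0) - q by rewrite opprB addrA.
  have := rP (q' + (h, 0)); rewrite -E1 => /(_ (lt_trans q'd dr)).
  have q'h : h < (q' + (h, 0)).1.
    rewrite /=; have := ler_norm (- (q' - (q - (h, 0))).1); rewrite normrN.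
    by have := norm_fst_le (q' - (q - (h, 0))); rewrite /=; lra.
  by rewrite /delay !leNgt q'h qh /= addrK subrK; lra.
- by move=> x; rewrite /delay /= h0 /base /= mulr0 subr0.
- move=> t x t0; rewrite /delay /=; case: (leP t h) => th //.
  by rewrite E; have := vl (t - h) x; rewrite subr_ge0 => /(_ (ltW th)); lra.
- move=> t k x t0 k0; rewrite /delay /= !E /base /=.
  have Ck := mulr_ge0 C0 k0.
  case: (leP (t + k) h) => tk; case: (leP t h) => th; try lra.
    (* The interval straddles the junction; [pc_up] controls the part after it. *)
    have tk0 : 0 <= t + k - h by lra.
    by have := pc_up x vS tk0; have := ler_wpM2l C0 th; lra.
  have th0 : 0 <= t - h by lra.
  by have := vt (t - h) k x th0 k0; rewrite addrAC; lra.
- move=> t x y t0; rewrite /delay /= !E; case: (leP t h) => th.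
    exact: (pc_space base_class).
  have th0 : 0 <= t - h by lra.
  by have := vx (t - h) x y th0; lra.
Qed.

Definition perron q : R := sup [set v q | v in perron_class].

Lemma perron_has_sup q : closed_halfspace q -> has_sup [set v q | v in perron_class].
Proof.
move=> q0; split; first by exists (base q), base => //; exact: base_class.
exists (u0 q.2 + C * q.1) => _ [v vS <-].
by rewrite {1}[q]surjective_pairing; exact: pc_up.
Qed.

Lemma perron_ge v q : perron_class v -> closed_halfspace q -> v q <= perron q.
Proof.
move=> vS q0; have [_ ub] := perron_has_sup q0.
by apply: ub_le_sup => //; exists v.
Qed.

Lemma perron_le q (B : R) : closed_halfspace q ->
  (forall v, perron_class v -> v q <= B) -> perron q <= B.
Proof.
move=> q0 H; apply: ge_sup; first by case: (perron_has_sup q0).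
by move=> _ [v vS <-]; exact: H.
Qed.

Lemma perron_init x : perron (0, x) = u0 x.
Proof.
have q0 : closed_halfspace ((0, x) : V) by rewrite /closed_halfspace /=.
apply/eqP; rewrite eq_le perron_le//=; last by move=> v vS; rewrite (pc_init vS).
by rewrite -(pc_init base_class); exact: perron_ge base_class q0.
Qed.

Lemma perron_time t h x : 0 <= t -> 0 <= h ->
  perron (t + h, x) <= perron (t, x) + C * h.
Proof.
move=> t0 h0; apply: perron_le => [|v vS].
  by rewrite /closed_halfspace /= addr_ge0.
apply: le_trans (pc_time vS x t0 h0) _; rewrite lerD2r.
exact: perron_ge.
Qed.

Lemma perron_time_low t h x : 0 <= t -> 0 <= h ->
  perron (t, x) - C * h <= perron (t + h, x).
Proof.
move=> t0 h0; rewrite lerBlDr; apply: perron_le => // v vS.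
rewrite -lerBlDr; apply: le_trans (perron_ge (delay_class h0 vS) _); last first.
  by rewrite /closed_halfspace /= addr_ge0.
rewrite /delay /=; case: (leP (t + h) h) => th.
  (* The base branch is reached only at [t = 0], where [v] equals [u0]. *)
  have t00 : t = 0 by lra.
  by rewrite t00 add0r (pc_init vS).
by rewrite (_ : _ - (h, 0) = (t, x))// [LHS]surjective_pairing /= subr0 addrK.
Qed.

Lemma perron_space t x y : 0 <= t -> perron (t, x) - perron (t, y) <= L * `|x - y|.
Proof.
move=> t0; rewrite lerBlDr; apply: perron_le => // v vS.
have := pc_space vS x y t0; have : v (t, y) <= perron (t, y) by exact: perron_ge.
lra.
Qed.

Lemma perron_lipschitz q q' : closed_halfspace q -> closed_halfspace q' ->
  `|perron q - perron q'| <= (C + L) * `|q - q'|.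
Proof.
have L_ge0 : 0 <= L by exact: le_trans G_ge0 G_le_L.
suff main q1 q2 : closed_halfspace q1 -> closed_halfspace q2 ->
    perron q1 - perron q2 <= (C + L) * `|q1 - q2|.
  move=> q0 q'0; rewrite ler_norml; have := main _ _ q0 q'0; have := main _ _ q'0 q0.
  by rewrite (distrC q') => ? ?; apply/andP; split; lra.
case: q1 q2 => [t x] [s y] t0 s0; rewrite /closed_halfspace /= in t0 s0.
have h1 : C * `|t - s| <= C * `|((t, x) : V) - (s, y)|.
  by rewrite ler_wpM2l//; exact: norm_fst_le ((t, x) - (s, y)).
have h2 : L * `|x - y| <= L * `|((t, x) : V) - (s, y)|.
  by rewrite ler_wpM2l//; exact: norm_snd_le ((t, x) - (s, y)).
have h3 := perron_space x y s0.
suff : perron (t, x) - perron (s, x) <= C * `|t - s| by lra.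
have [ts|st] := leP t s.
  have d0 : 0 <= s - t by lra.
  have := perron_time_low x t0 d0; rewrite (_ : t + (s - t) = s); last by ring.
  by rewrite distrC ger0_norm//; lra.
have d0 : 0 <= t - s by lra.
have := perron_time x s0 d0; rewrite (_ : s + (t - s) = t); last by ring.
by rewrite ger0_norm//; lra.
Qed.

Lemma perron_uc : unif_continuous_on (@closed_halfspace R n) perron.
Proof.
apply: (lipschitz_clamp_continuous (L := C + L)); last exact: perron_lipschitz.
by rewrite addr_ge0//; exact: le_trans G_ge0 G_le_L.
Qed.

Lemma perron_sub : viscosity_subsolution F perron.
Proof.
apply: stability_sub => //.
  by move=> q q0; exact: uc_continuous_open perron_uc q0.
move=> q e q0 e0; have q0' := ltW q0 : closed_halfspace q.
have [_ [v vS <-] vq] := sup_adherent e0 (perron_has_sup q0').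
exists v; split; [exact: (pc_sub vS)|exact: ltW|].
move=> q' q'0; apply: (le_trans (perron_ge vS (ltW q'0 : closed_halfspace q'))).
by rewrite lerDl ltW.
Qed.

(** The supremum is thus the largest member, so no raised version of it can belong to the class. *)
Lemma perron_in_class : perron_class perron.
Proof.
split; [exact: perron_sub|exact: perron_init| |exact: perron_time|exact: perron_space].
move=> t x t0; apply: (le_trans (pc_low base_class x t0)).
exact: perron_ge base_class _.
Qed.

(** [perron] lies above a cone of opening [T / 2]. Steepening this cone to [T] leaves room to lift
    its vertex by [T * r / 8] while staying below [perron] outside radius [r / 4]. *)
Lemma perron_raise q0 a p (T r : R) : 0 < T -> 0 < r -> r < q0.1 ->
  a + T <= C -> `|p| <= L0 -> T <= 1 ->
  (forall q, `|q - q0| < r ->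
     perron q0 + ell a p (q - q0) - T / 2 * `|q - q0| <= perron q) ->
  (forall psi q, C1_test psi -> open_halfspace q -> `|q - q0| < r ->
     `|dt psi q - a| <= T -> `|Dx psi q - p| <= T ->
     dt psi q + F (q.2, Dx psi q) <= 0) -> False.
Proof.
move=> T0 r0 rq0 aT pL T1 ulow btest; have C0 := C_ge0.
pose b := cone (perron q0 + T / 2 * (r / 4)) a p T q0.
have bu q : r / 4 <= `|q - q0| -> `|q - q0| < r -> b q <= perron q.
  move=> q1 /ulow; rewrite /b /cone.
  have : T / 2 * (r / 4) <= T / 2 * `|q - q0| by rewrite ler_pM2l// divr_gt0.
  lra.
have bdir z k : - ell a p z + T * `|z| <= k ->
    forall q s, 0 <= s -> b q - b (q + s *: z) <= k * s.
  move=> zk q s s0.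
  have := cone_dir (perron q0 + T / 2 * (r / 4)) a p q0 q z (ltW T0) s0.
  rewrite -/b ler_norml => /andP[h _]; have := ler_wpM2r s0 zk; lra.
have wS : perron_class (raise perron b q0 r).
  split.
  - apply: raise_sub => //; first exact: perron_sub.
      by move=> q; apply: cone_continuous; exact: ltW.
    move=> psi q psi1 qo qr qmax; have [dpsi _ _] := psi1 q qo.
    have [h1 h2] := cone_test (ltW T0) dpsi qmax.
    exact: btest.
  - move=> x; rewrite raise_out ?perron_init//.
    have := norm_fst_le (((0, x) : V) - q0); rewrite /= sub0r normrN.
    by have := ler_norm q0.1; lra.
  - move=> t x t0; apply: le_trans (raise_ge _ _ _ _ _).
    exact: (pc_low perron_in_class).
  - move=> t h x t0 h0.
    have E (s : R) (q : V) : q + s *: (- ((1, 0) : V)) = (q.1 - s, q.2).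
      rewrite [LHS]surjective_pairing /= oppr0 scaler0 addr0.
      by rewrite -[s *: -1]/(s * -1) mulrN1.
    (* An upper slope forward in time is a bound on the descent backward in time. *)
    have := @raise_dir _ _ perron b q0 r r0 rq0 bu (- (1, 0)) C.
    move=> /(_ _ _ (t + h, x) h h0); rewrite E /= addrK lerBlDl; apply => //.
    + move=> q s s0 q1; rewrite E => q2; rewrite lerBlDl.
      by have := perron_time q.2 q2 s0; rewrite /= subrK -surjective_pairing addrC.
    + by apply: bdir; rewrite ellN opprK ell_time normrN norm_time mulr1.
    + by rewrite /closed_halfspace /= addr_ge0.
  - move=> t x y t0.
    have E (s : R) (q : V) : q + s *: ((0, y - x) : V) = (q.1, q.2 + s *: (y - x)).
      by rewrite [LHS]surjective_pairing /= scaler0 addr0.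
    have := @raise_dir _ _ perron b q0 r r0 rq0 bu (0, y - x) (L * `|x - y|).
    move=> /(_ _ _ (t, x) 1 ler01); rewrite E /= scale1r mulr1 (addrC x (y - x)) subrK; apply => //.
    + move=> q s s0 q1; rewrite E => _.
      rewrite {1}[q]surjective_pairing; apply: le_trans (perron_space _ _ q1) _.
      rewrite opprD addrA subrr sub0r normrN normrZ ger0_norm// distrC.
      by rewrite [s * _]mulrC mulrA.
    + apply: bdir; have h1 := ell_le a (y - x) pL.
      have h2 := ler_norm (- ell a p (0, y - x)).
      have h3 : `|((0, y - x) : V)| <= `|y - x|.
        by rewrite prod_norm_le /= normr0 normr_ge0 lexx.
      have h4 : T * `|((0, y - x) : V)| <= `|y - x|.
        by apply: le_trans h3; rewrite ler_piMl.
      have h5 : (n%:R * L0 + 1) * `|y - x| <= L * `|y - x| by rewrite ler_wpM2r.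
      rewrite normrN in h2; rewrite (distrC x); lra.
have q0c : closed_halfspace q0 by rewrite /closed_halfspace /=; lra.
have := perron_ge wS q0c; apply/negP; rewrite -ltNge.
apply: lt_le_trans (raise_ge_b _ _ _); last by rewrite subrr normr0.
rewrite /b /cone subrr normr0 mulr0 subr0 -(scale0r (0 : V)) ellZ mul0r addr0.
by rewrite ltrDl mulr_gt0// divr_gt0.
Qed.

Lemma perron_super : viscosity_supersolution F perron.
Proof.
split; first by case: perron_sub.
move=> phi q0 phi1 q00 /nearP_norm[r1 r10 qmin]; rewrite leNgt; apply/negP => neg.
have [dphi _ _] := phi1 q0 q00; have C0 := C_ge0.
have a_ge : - C <= dt phi q0.
  have umax : local_max (fun q => - perron q - - phi q) q0.
    by apply/nearP_norm; exists r1 => // q /qmin; lra.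
  have dphiN : differentiable (fun q => - phi q) q0 by exact: differentiableN.
  have : - C <= 'D_(- ((1, 0) : V)) (fun q => - phi q) q0.
    apply: (local_max_derive_ge (r := q0.1) dphiN umax) => // s s0 sq.
    have t0 : 0 <= q0.1 - s by lra.
    have := perron_time_low q0.2 t0 (ltW s0); rewrite subrK -surjective_pairing.
    rewrite (_ : q0 + _ = (q0.1 - s, q0.2)); first lra.
    rewrite [LHS]surjective_pairing /= oppr0 scaler0 addr0.
    by rewrite -[s *: -1]/(s * -1) mulrN1.
  by rewrite deriveNv// -/(dt (fun q => - phi q) q0) dtN// opprK.
have a_lt : dt phi q0 < C by have := F_ge_C q0.2 (Dx phi q0); lra.
have p_lt : `|Dx phi q0| <= L0.
  by rewrite leNgt; apply/negP => /ltW/(F_coercive q0.2); lra.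
(* Half of the violation is spent on the variation of [dt], half on that of [F]. *)
pose g := - (dt phi q0 + F (q0.2, Dx phi q0)) / 2.
have g0 : 0 < g by rewrite divr_gt0//; lra.
have /contP_norm/(_ g g0)[d d0 dP] := Fcont (x := (q0.2, Dx phi q0)).
have [T1 [T10 T1d T1g T11]] := pick_below d0 g0 ltr01.
have Ca : 0 < C - dt phi q0 by lra.
have [T [T0 TT1 TC _]] := pick_below T10 Ca ltr01.
have T20 : 0 < T / 2 by rewrite divr_gt0.
(* The error [T / 2] in the linearisation is the opening of the lower cone required by
   [perron_raise]. *)
have [r2 r20 r2P] := diff_approx dphi T20.
have [r3 [r30 r31 r32 r3d]] := pick_below r10 r20 d0.
have [r [r_gt0 rr3 rq0 _]] := pick_below r30 q00 ltr01.
apply: (perron_raise (q0 := q0) (a := dt phi q0) (p := Dx phi q0) (T := T) (r := r)) => //.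
- lra.
- lra.
- move=> q qr.
  have := qmin q (lt_trans qr (lt_trans rr3 r31)).
  have := r2P q (lt_trans qr (lt_trans rr3 r32)).
  by rewrite diff_ell// ler_norml => /andP[]; lra.
- move=> psi q psi1 qo qr h1 h2.
  have : `|F (q.2, Dx psi q) - F (q0.2, Dx phi q0)| < g.
    apply: dP; rewrite prod_normE gt_max; apply/andP; split => /=.
      by apply: le_lt_trans (norm_snd_le (q - q0)) _; lra.
    by apply: le_lt_trans h2 _; lra.
  have gE : dt phi q0 + F (q0.2, Dx phi q0) = - 2 * g by rewrite /g; field.
  by move: h1; rewrite ler_norml ltr_norml => /andP[h3 h4] /andP[h5 h6]; lra.
Qed.

Lemma perron_solution : uc_solution F u0 perron.
Proof.
split; [exact: perron_uc|exact: perron_init|].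
by split; [exact: perron_sub|exact: perron_super].
Qed.

End Perron.

(** * Uniformly continuous initial data *)

Section Main.
Context {R : realType} {n : nat}.
Local Notation V := (R * 'rV[R]_n)%type.
Implicit Types (F : 'rV[R]_n * 'rV[R]_n -> R) (u v : V -> R).

Lemma cond_F1_bound F (r : R) : cond_F1 F ->
  exists2 B : R, 0 <= B & forall x p, enorm p <= r -> `|F (x, p)| <= B.
Proof.
move=> F1; have [|[M [_ MP]] _] := F1 (`|r| + 1); first by rewrite ltr_wpDl.
exists (`|M| + 1); first by rewrite addr_ge0.
move=> x p pr; apply: MP.
  by have := ler_norm M; lra.
by split => //; rewrite /eball /=; have := ler_norm r; lra.
Qed.

(** For fixed [p], (F1) bounds [F] below in [x], so the real [inf] is a genuine lower bound. *)
Lemma cond_F2_coercive F : cond_F1 F -> cond_F2 F ->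
  forall M, exists r : R, forall x p, r <= enorm p -> M <= F (x, p).
Proof.
move=> F1 F2 M; have [r rP] := F2 M; exists r => x p /rP MF; apply: le_trans MF _.
have [B _ BP] := cond_F1_bound (enorm p) F1.
apply: ge_inf; last by exists x.
exists (- B) => _ [y _ <-]; have := BP y p (lexx _).
by rewrite ler_norml => /andP[].
Qed.

Lemma perron_constants F (G : R) : cond_F1 F -> cond_F2 F ->
  exists C L0 : R, [/\ 0 <= C, 0 <= L0,
    forall x p, `|p| <= G -> F (x, p) <= C,
    forall x p, - C <= F (x, p) &
    forall x (p : 'rV[R]_n), L0 <= `|p| -> C <= F (x, p)].
Proof.
move=> F1 F2.
have [B1 B10 B1P] := cond_F1_bound (n%:R * G) F1.
have [r0 r0P] := cond_F2_coercive F1 F2 0.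
have [B2 B20 B2P] := cond_F1_bound r0 F1.
(* [B1] bounds [F] on the momenta of the datum; [B2] bounds it where coercivity does not yet give
   [0 <= F]. Only then can the coercivity level [C = B1 + B2] be imposed. *)
have [r rP] := cond_F2_coercive F1 F2 (B1 + B2).
exists (B1 + B2), `|r|; split => //.
- exact: addr_ge0.
- move=> x p pG; have : enorm p <= n%:R * G.
    by apply: le_trans (enorm_le_norm p) _; rewrite ler_wpM2l.
  by move=> /(B1P x); rewrite ler_norml => /andP[]; lra.
- move=> x p; have [/(r0P x)|/ltW/(B2P x)] := leP r0 (enorm p); first lra.
  by rewrite ler_norml => /andP[]; lra.
- move=> x p rp; apply: rP; apply: le_trans (norm_le_enorm p).
  exact: le_trans (ler_norm r) rp.
Qed.

(** [K] is quantified before [u0], as the claim on the Lipschitz constant requires. *)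
Lemma lipschitz_solution F (G : R) : hamiltonian F -> cond_F1 F -> cond_F2 F ->
  0 <= G -> exists2 K : R, 0 <= K & forall u0 : 'rV[R]_n -> R,
    (forall x y, `|u0 x - u0 y| <= G * `|x - y|) ->
    exists2 u, uc_solution F u0 u &
      forall q q', closed_halfspace q -> closed_halfspace q' ->
        `|u q - u q'| <= K * `|q - q'|.
Proof.
move=> Fc F1 F2 G0; have [C [L0 [C0 L00 h1 h2 h3]]] := perron_constants G F1 F2.
pose L := G + (n%:R * L0 + 1).
have nL0 : 0 <= n%:R * L0 by rewrite mulr_ge0.
have LG : G <= L by rewrite /L; lra.
have LL : n%:R * L0 + 1 <= L by rewrite /L; lra.
exists (C + L); first lra.
move=> u0 u0G; exists (perron F u0 C L).
  exact: (perron_solution Fc C0 G0 LG LL u0G h1 h2 h3).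
exact: (perron_lipschitz C0 G0 LG u0G h1).
Qed.

Lemma solution_le F (u0 v0 : 'rV[R]_n -> R) u v (A L : R) :
  ham_uc F -> 0 <= L -> uc_solution F u0 u -> uc_solution F v0 v ->
  (forall q q', closed_halfspace q -> closed_halfspace q' ->
    `|v q - v q'| <= L * `|q - q'|) ->
  (forall x, u0 x <= v0 x + A) ->
  forall q, closed_halfspace q -> u q <= v q + A.
Proof.
move=> Fuc L0 [uu ui [us _]] [_ vi [_ vs]] vL uv; apply: (comparison Fuc L0) => //.
by move=> x; rewrite ui vi.
Qed.

(** Here the Lipschitz function is the smaller one, so comparison is applied to [- u] and [- v] with
    the dual Hamiltonian. *)
Lemma solution_ge F (u0 v0 : 'rV[R]_n -> R) u v (A L : R) :
  ham_uc F -> 0 <= L -> uc_solution F u0 u -> uc_solution F v0 v ->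
  (forall q q', closed_halfspace q -> closed_halfspace q' ->
    `|v q - v q'| <= L * `|q - q'|) ->
  (forall x, v0 x <= u0 x + A) ->
  forall q, closed_halfspace q -> v q <= u q + A.
Proof.
move=> Fuc L0 [uu ui [_ us]] [_ vi [vs _]] vL uv q q0.
suff : - u q <= - v q + A by lra.
apply: (comparison (u := fun q => - u q) (v := fun q => - v q) (dual_ham_uc Fuc) L0) => //.
- exact: super_subN.
- exact: subN_superN.
- move/uconP_norm: uu => uu; apply/uconP_norm => e /uu[d d0 dP]; exists d => //.
  by move=> x y x0 y0 /(dP x y x0 y0); rewrite -opprD normrN.
- by move=> x y x0 y0; rewrite -opprD normrN; exact: vL.
- by move=> x; rewrite ui vi; have := uv x; lra.
Qed.

(** The function [g] is the infimum over [y] of [f y + M * |x - y|]. Taking [y = x] gives [g <= f];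
    the growth hypothesis bounds every competitor below by [f x - e]. *)
Lemma inf_convolution (f : 'rV[R]_n -> R) (e M : R) : 0 <= M ->
  (forall x y, `|f x - f y| <= e + M * `|x - y|) ->
  exists g : 'rV[R]_n -> R, (forall x y, `|g x - g y| <= M * `|x - y|) /\
    forall x, g x <= f x /\ f x <= g x + e.
Proof.
move=> M0 fM; pose S x := [set f y + M * `|x - y| | y in [set: 'rV[R]_n]].
have Slb x y : f x - e <= f y + M * `|x - y|.
  by have := fM x y; rewrite ler_norml => /andP[_]; lra.
have Shas x : has_inf (S x).
  split; first by exists (f x + M * `|x - x|), x.
  by exists (f x - e) => _ [y _ <-].
have Sle x y : inf (S x) <= f y + M * `|x - y|.
  by apply: ge_inf; [case: (Shas x)|exists y].
have Slip x y : inf (S x) - inf (S y) <= M * `|x - y|.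
  rewrite lerBlDr -lerBlDl; apply: lb_le_inf; first by case: (Shas y).
  move=> _ [z _ <-]; have := Sle x z.
  by have := ler_wpM2l M0 (ler_distD y x z); lra.
exists (fun x => inf (S x)); split.
  move=> x y; rewrite ler_norml; have := Slip x y; have := Slip y x.
  by rewrite (distrC y) => ? ?; apply/andP; split; lra.
move=> x; split; first by have := Sle x x; rewrite subrr normr0 mulr0 addr0.
rewrite -lerBlDr; apply: lb_le_inf; first by case: (Shas x).
by move=> _ [y _ <-].
Qed.

Lemma approx_solution F (u0 : 'rV[R]_n -> R) (e : R) :
  hamiltonian F -> cond_F1 F -> cond_F2 F -> unif_continuous u0 -> 0 < e ->
  exists u f (K : R), [/\ 0 <= K, uc_solution F f u,
    forall q q', closed_halfspace q -> closed_halfspace q' ->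
      `|u q - u q'| <= K * `|q - q'| &
    forall x, f x <= u0 x /\ u0 x <= f x + e].
Proof.
move=> Fc F1 F2 /ucP_norm u0c e0; have [d d0 dP] := u0c e e0.
have M0 : 0 <= e / d by rewrite divr_ge0// ltW.
have growth := linear_growth (A := setT) (fun _ _ _ _ _ _ _ => I) e0 d0
  (fun x y _ _ => dP x y).
have [f [fL fe]] := inf_convolution M0 (fun x y => growth x y I I).
have [K K0 KP] := lipschitz_solution Fc F1 F2 M0.
by have [u uf uK] := KP f fL; exists u, f, K.
Qed.

Lemma grad_sup_norm_lipschitz (u0 : 'rV[R]_n -> R) (k : R) :
  lipschitz_with (@enorm R n) setT k u0 ->
  forall x y, `|u0 x - u0 y| <= grad_sup_norm u0 * enorm (x - y).
Proof.
move=> u0k x y; have [->|xy] := eqVneq x y.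
  by rewrite !subrr normr0 /enorm big1 ?sqrtr0 ?mulr0// => i _; rewrite mxE expr0n.
have pos (z : 'rV[R]_n * 'rV[R]_n) : z.1 != z.2 -> 0 < enorm (z.1 - z.2).
  by move=> z12; apply: lt_le_trans (norm_le_enorm _); rewrite normr_gt0 subr_eq0.
rewrite -ler_pdivrMr; last exact: (pos (x, y)).
apply: ub_le_sup; last by exists (x, y).
exists k => _ [z z12 <-]; rewrite ler_pdivrMr; last exact: pos.
exact: u0k.
Qed.

(** * Uniform limits of approximate solutions *)

Section Limit.
Variables (F : 'rV[R]_n * 'rV[R]_n -> R) (u0 : 'rV[R]_n -> R) (w : R -> V -> R) (u : V -> R).
Hypothesis Fcont : hamiltonian F.
Hypothesis w_sol : forall e : R, 0 < e -> exists f : 'rV[R]_n -> R,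
  uc_solution F f (w e) /\ forall x, f x <= u0 x /\ u0 x <= f x + e.
Hypothesis w_le : forall e q, 0 < e -> closed_halfspace q -> w e q <= u q.
Hypothesis le_w : forall e q, 0 < e -> closed_halfspace q -> u q <= w e q + e.

Lemma limit_uc : unif_continuous_on (@closed_halfspace R n) u.
Proof.
apply/uconP_norm => e e0; have e20 : 0 < e / 2 by rewrite divr_gt0.
have [f [[/uconP_norm/(_ _ e20)[d d0 dP] _ _] _]] := w_sol e20.
exists d => // x y x0 y0 /(dP x y x0 y0); rewrite !ltr_norml => /andP[h1 h2].
have := w_le e20 x0; have := w_le e20 y0; have := le_w e20 x0; have := le_w e20 y0.
by move=> *; apply/andP; split; lra.
Qed.

Lemma limit_solution : uc_solution F u0 u.
Proof.
have uc q : open_halfspace q -> {for q, continuous u}.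
  by move=> q0; exact: uc_continuous_open limit_uc q0.
split; first exact: limit_uc.
  move=> x; have x0 : closed_halfspace ((0, x) : V) by rewrite /closed_halfspace /=.
  have close e : 0 < e -> u (0, x) <= u0 x + e /\ u0 x <= u (0, x) + e.
    move=> e0; have [f [[_ fi _] /(_ x)]] := w_sol e0; rewrite -fi.
    by have := w_le e0 x0; have := le_w e0 x0; split; lra.
  by apply/eqP; rewrite eq_le; apply/andP; split; apply/ler_addgt0Pr => e /close[].
split.
  apply: stability_sub => // q e q0 e0; have [f [[_ _ [ws _]] _]] := w_sol e0.
  exists (w e); split => //; first by have := le_w e0 (ltW q0 : closed_halfspace q); lra.
  by move=> q' q'0; have := w_le e0 (ltW q'0 : closed_halfspace q'); lra.
apply: subN_super; apply: stability_sub.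
- exact: continuous_dual_ham.
- by move=> q /uc /continuousNfun.
- move=> q e q0 e0; have [f [[_ _ [_ ws]] _]] := w_sol e0.
  exists (fun q => - w e q); split; first exact: super_subN.
    by have := w_le e0 (ltW q0 : closed_halfspace q); lra.
  by move=> q' q'0; have := le_w e0 (ltW q'0 : closed_halfspace q'); lra.
Qed.

End Limit.

End Main.

Theorem theoremA1 (R : realType) (n : nat) (F : 'rV[R]_n * 'rV[R]_n -> R)
    (HF : hamiltonian F) (HF1 : cond_F1 F) (HF2 : cond_F2 F) :
  (forall u0 : 'rV[R]_n -> R, unif_continuous u0 ->
    exists u : R * 'rV[R]_n -> R, uc_solution F u0 u /\
      forall v : R * 'rV[R]_n -> R, uc_solution F u0 v ->
        forall q, closed_halfspace q -> v q = u q) /\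
  (exists Lam : R -> R, forall (u0 : 'rV[R]_n -> R) (u : R * 'rV[R]_n -> R),
    (exists k : R, lipschitz_with (@enorm R n) [set: 'rV[R]_n] k u0) ->
    uc_solution F u0 u ->
    lipschitz_with (@st_enorm R n) (@closed_halfspace R n)
      (Lam (grad_sup_norm u0)) u).
Proof.
have Fuc := cond_F1_uc HF1; split.
  move=> u0 u0c.
  have /choice[w wP] : forall e : R, exists u : R * 'rV[R]_n -> R, 0 < e ->
      exists f (K : R), [/\ 0 <= K, uc_solution F f u,
        forall q q', closed_halfspace q -> closed_halfspace q' ->
          `|u q - u q'| <= K * `|q - q'| &
        forall x, f x <= u0 x /\ u0 x <= f x + e].
    move=> e; have [e0|e0] := ltP 0 e.
      by have [u H] := approx_solution HF HF1 HF2 u0c e0; exists u.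
    by exists (fun=> 0).
  (* The datum of [w e'] is at most [u0], hence at most that of [w e] plus [e], in whichever order
     [e] and [e'] stand. The supremum over all [e] is therefore squeezed between [w e] and
     [w e + e], without any monotonicity. *)
  have w_w e e' q : 0 < e -> 0 < e' -> closed_halfspace q -> w e' q <= w e q + e.
    move=> e0 e'0; have [f [K [K0 fs wK fe]]] := wP e e0.
    have [f' [K' [_ fs' _ fe']]] := wP e' e'0.
    apply: (solution_le Fuc K0 fs' fs wK) => x.
    by have := fe x; have := fe' x; lra.
  pose u q := sup [set w e q | e in [set e : R | 0 < e]].
  have w_le e q : 0 < e -> closed_halfspace q -> w e q <= u q.
    move=> e0 q0; apply: ub_le_sup; last by exists e.
    by exists (w 1 q + 1) => _ [e' e'0 <-]; exact: w_w.
  have le_w e q : 0 < e -> closed_halfspace q -> u q <= w e q + e.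
    move=> e0 q0; apply: ge_sup; first by exists (w 1 q), 1 => //=.
    by move=> _ [e' e'0 <-]; exact: w_w.
  have us : uc_solution F u0 u.
    apply: (limit_solution HF _ w_le le_w) => e e0.
    by have [f [K [_ fs _ fe]]] := wP e e0; exists f.
  exists u; split => // v vs q q0.
  have close e : 0 < e -> v q <= u q + e /\ u q <= v q + e.
    move=> e0; have [f [K [K0 fs wK fe]]] := wP e e0.
    have := solution_le Fuc K0 vs fs wK (fun x => (fe x).2) q0.
    have f_le x : f x <= u0 x + 0 by have := fe x; lra.
    have := solution_ge Fuc K0 vs fs wK f_le q0.
    by have := w_le e q e0 q0; have := le_w e q e0 q0; split; lra.
  by apply/eqP; rewrite eq_le; apply/andP; split; apply/ler_addgt0Pr => e /close[].
(* [Lam] must be defined for every real [g], hence the absolute value; the factor [n] converts the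
   Euclidean slope of the datum to the sup norm. *)
have /choice[Lam LamP] : forall g : R, exists K : R, 0 <= K /\
    forall u0 : 'rV[R]_n -> R,
      (forall x y, `|u0 x - u0 y| <= `|g| * n%:R * `|x - y|) ->
      exists2 u, uc_solution F u0 u &
        forall q q', closed_halfspace q -> closed_halfspace q' ->
          `|u q - u q'| <= K * `|q - q'|.
  move=> g; have [|K K0 KP] := lipschitz_solution (G := `|g| * n%:R) HF HF1 HF2.
    by rewrite mulr_ge0.
  by exists K.
exists Lam => u0 u [k u0k] us q q' q0 q'0.
have [K0 KP] := LamP (grad_sup_norm u0).
have [x y|v vs vK] := KP u0.
  apply: le_trans (grad_sup_norm_lipschitz u0k x y) _.
  apply: (@le_trans _ _ (`|grad_sup_norm u0| * enorm (x - y))).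
    by rewrite ler_wpM2r ?sqrtr_ge0// ler_norm.
  by rewrite -mulrA ler_wpM2l// enorm_le_norm.
(* The given [u] is not known to be Lipschitz; comparison with the constructed Lipschitz solution
   [v] on both sides identifies the two. *)
have uv z : closed_halfspace z -> u z = v z.
  move=> z0; have u00 x : u0 x <= u0 x + 0 by rewrite addr0.
  have := solution_le Fuc K0 us vs vK u00 z0; have := solution_ge Fuc K0 us vs vK u00 z0.
  by rewrite !addr0 => ? ?; apply/eqP; rewrite eq_le; apply/andP.
rewrite !uv//; apply: le_trans (vK q q' q0 q'0) _.
by rewrite ler_wpM2l// norm_le_st_enorm.
Qed.
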